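(* For any prime $p>2$ and any field $k$ of characteristic $p$, the $T$-space $CP(G)$ of $k_1\langle X\rangle$, where $G$ is the infinite dimensional unitary Grassmann algebra over $k$, is not finitely based.
   Context: $X=\{x_i\mid i\ge 0\}$ is a countably infinite set; $k_0\langle X\rangle$ is the free (nonunitary) associative $k$-algebra on $X$, contained in $k_1\langle X\rangle$, the free unitary associative $k$-algebra on $X$. A $T$-space of $k_1\langle X\rangle$ is a linear subspace of $k_1\langle X\rangle$ invariant under every (unitary) $k$-algebra endomorphism of $k_1\langle X\rangle$. For a subset $H$, the $T$-space generated by $H$ is the smallest $T$-space containing $H$. A $T$-space is finitely based if it is the $T$-space generated by some finite subset. The infinite dimensional unitary Grassmann algebra $G$ over $k$ is the unitary associative algebra generated by $e_i$, $i\ge1$, with $e_ie_j=-e_je_i$ and $e_i^2=0$ for all $i,j$, having linear basis $\{1\}\cup\{e_{i_1}e_{i_2}\cdots e_{i_n}\mid n\ge1,\ i_1<i_2<\cdots<i_n\}$. For a unitary $k$-algebra $A$, $T(A)$ is the set of all $f\in k_0\langle X\rangle$ lying in the kernel of every unitary homomorphism $k_1\langle X\rangle\to A$. A central polynomial of $A$ is an element $f\in k_0\langle X\rangle$ with $f\notin T(A)$ whose image under every unitary homomorphism $k_1\langle X\rangle\to A$ lies in the centre of $A$. $CP(A)$ is the $T$-space of $k_1\langle X\rangle$ generated by the set of all central polynomials of $A$. *)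

(* Defs.v *)
From HB Require Import structures.
From mathcomp Require Import all_boot all_order all_algebra.
From mathcomp Require Import finmap.
From mathcomp Require Import mathcomp_extra boolp classical_sets cardinality.
From mathcomp Require Import monalg.

Set Implicit Arguments.
Unset Strict Implicit.
Unset Printing Implicit Defensive.

Import GRing.Theory.

Local Open Scope ring_scope.
Local Open Scope classical_set_scope.

(* The free unitary associative algebra k_1<X> on X = {x_i | i >= 0}: the
   algebra of the free monoid on nat, x_i being the word of length one i.
   The alias carries the algType structure, which monalg only provides for
   commutative monoids. *)
Definition free_alg (k : fieldType) : Type := {malg k[{fmonom nat}]}.

HB.instance Definition _ (k : fieldType) :=
  GRing.Lalgebra.copy (free_alg k) {malg k[{fmonom nat}]}.

Fact free_alg_scaleAr (k : fieldType) (c : k) (f g : free_alg k) :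
  c *: (f * g) = f * (c *: g).
Proof.
rewrite -[RHS]mulr1 -[1]scale1r; apply/malgP => m.
rewrite scale1r mulr1 mcoeffZ !mcoeffMl mulr_sumr; apply/eq_bigr => i _.
have le : (msupp (c *: g) `<=` msupp g)%fset by apply: msuppZ_le.
rewrite (big_fset_incl _ le) /=; last first.
  by move=> x _ /mcoeff_outdom ->; rewrite mulr0 mul0rn.
rewrite mulr_sumr; apply/eq_bigr => j _.
by rewrite mcoeffZ mulrnAr !mulrA [c * _]mulrC.
Qed.

HB.instance Definition _ (k : fieldType) :=
  GRing.Lalgebra_isAlgebra.Build k (free_alg k) (@free_alg_scaleAr k).

Definition freeX (k : fieldType) (i : nat) : free_alg k := << fmu i >>.

(* The free nonunitary algebra k_0<X>, as a subset of k_1<X>: the elements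
   in which the empty word does not occur. *)
Definition free_alg0 (k : fieldType) : set (free_alg k) :=
  [set f : free_alg k | mcoeff (mone : {fmonom nat}) f = 0].

Definition Tspace (k : fieldType) (S : set (free_alg k)) : Prop :=
  [/\ S 0,
      forall (c : k) f g, S f -> S g -> S (c *: f + g)
    & forall (phi : {lrmorphism free_alg k -> free_alg k}) f,
        S f -> S (phi f)].

Definition Tspace_gen (k : fieldType) (H : set (free_alg k)) :
  set (free_alg k) := smallest (@Tspace k) H.

Definition finitely_based (k : fieldType) (S : set (free_alg k)) : Prop :=
  exists2 H : set (free_alg k), finite_set H & S = Tspace_gen H.

Definition centre (R : nzRingType) : set R :=
  [set z | forall a : R, GRing.comm z a].

Definition Tid (k : fieldType) (A : algType k) : set (free_alg k) :=
  [set f | free_alg0 f /\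
           forall phi : {lrmorphism free_alg k -> A}, phi f = 0].

Definition central_polynomial (k : fieldType) (A : algType k) :
    set (free_alg k) :=
  [set f | [/\ free_alg0 f, ~ Tid A f
             & forall phi : {lrmorphism free_alg k -> A},
                 @centre A (phi f)]].

Definition CP (k : fieldType) (A : algType k) : set (free_alg k) :=
  Tspace_gen (central_polynomial A).

(* e_{i_1} * ... * e_{i_n} for s = [:: i_1; ...; i_n], hence 1 for s = [::] *)
Definition gmon (k : fieldType) (G : algType k) (e : nat -> G)
    (s : seq nat) : G :=
  \prod_(i <- s) e i.

(* G is the infinite dimensional unitary Grassmann algebra over k, on the
   generators e (numbered from 0 instead of 1).  The last two fields say that
   the gmon e s with s strictly increasing, gmon e [::] = 1 included, form a
   linear basis of G; in particular G is generated by e as a unitary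
   algebra. *)
Record is_grassmann (k : fieldType) (G : algType k) (e : nat -> G) : Prop :=
  IsGrassmann {
    grassmann_anti : forall i j, e i * e j = - (e j * e i);
    grassmann_sq : forall i, e i * e i = 0;
    grassmann_free : forall (S : seq (seq nat)) (c : seq nat -> k),
      uniq S -> all (sorted ltn) S ->
      \sum_(s <- S) c s *: gmon e s = 0 -> forall s, s \in S -> c s = 0;
    grassmann_span : forall x : G,
      exists (S : seq (seq nat)) (c : seq nat -> k),
        all (sorted ltn) S /\ x = \sum_(s <- S) c s *: gmon e s
  }.

(* The free module on the finite sets of indices, a set A standing for the
   product of its e_i in increasing order, realizes is_grassmann over every
   field. *)
Module GrassmannModel.
Section Model.
Variable k : fieldType.
Local Open Scope fset_scope.

Implicit Types A B C : {fset nat}.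

(* number of transpositions needed to sort the concatenation of A and B *)
Definition inv A B : nat := (\sum_(a <- A) \sum_(b <- B) (b < a))%N.

Definition sgn A B : k :=
  if [disjoint A & B]%fset then (-1) ^+ inv A B else 0.

Lemma big_fsetUd (F : nat -> nat) A B : [disjoint A & B]%fset ->
  (\sum_(a <- A `|` B) F a = \sum_(a <- A) F a + \sum_(a <- B) F a)%N.
Proof.
move=> dAB; rewrite -big_cat; apply/perm_big/uniq_perm.
- exact: fset_uniq.
- rewrite cat_uniq !fset_uniq andbT /=; apply/hasPn => x xB.
  by apply: (fdisjointP_sym dAB) xB.
- by move=> x; rewrite mem_cat inE.
Qed.

Lemma invUl A B C : [disjoint A & B]%fset ->
  inv (A `|` B) C = (inv A C + inv B C)%N.
Proof. exact: big_fsetUd. Qed.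

Lemma invUr A B C : [disjoint B & C]%fset ->
  inv A (B `|` C) = (inv A B + inv A C)%N.
Proof.
move=> dBC; rewrite /inv -big_split; apply: eq_bigr => a _.
exact: big_fsetUd.
Qed.

Lemma sgnA A B C : sgn A B * sgn (A `|` B) C = sgn B C * sgn A (B `|` C).
Proof.
rewrite /sgn fdisjointUX fdisjointXU.
case: (boolP [disjoint A & B]%fset) => dAB;
  case: (boolP [disjoint B & C]%fset) => dBC;
  case: (boolP [disjoint A & C]%fset) => dAC /=; rewrite ?(mul0r, mulr0) //.
rewrite invUl // invUr // -!exprD; congr (_ ^+ _).
by rewrite [RHS]addnC addnA.
Qed.

Lemma sgn0A A : sgn fset0 A = 1.
Proof. by rewrite /sgn fdisjoint0X /inv big_seq_fset0 expr0. Qed.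

Lemma sgnA0 A : sgn A fset0 = 1.
Proof.
rewrite /sgn fdisjointX0 /inv big1 ?expr0 // => a _.
by rewrite big_seq_fset0.
Qed.

Definition gr : Type := {malg k[{fset nat}]}.
HB.instance Definition _ := GRing.Lmodule.copy gr {malg k[{fset nat}]}.

Definition mon A : gr := << A >>.

Definition mul (f g : gr) : gr :=
  \sum_(A <- msupp f) \sum_(B <- msupp g)
     (mcoeff A f * mcoeff B g * sgn A B) *: mon (A `|` B).

Lemma mulw (d1 d2 : {fset {fset nat}}) (f g : gr) :
  msupp f `<=` d1 -> msupp g `<=` d2 ->
  mul f g = \sum_(A <- d1) \sum_(B <- d2)
     (mcoeff A f * mcoeff B g * sgn A B) *: mon (A `|` B).
Proof.
move=> le1 le2; rewrite /mul (big_fset_incl _ le1) /=.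
  apply/eq_bigr => A _; apply/big_fset_incl => // B _ /mcoeff_outdom ->.
  by rewrite mulr0 mul0r scale0r.
move=> A _ /mcoeff_outdom fA.
by rewrite big1 // => B _; rewrite fA !mul0r scale0r.
Qed.

Lemma mulDl : left_distributive mul +%R.
Proof.
move=> f g h; have le1 := fsubsetUl (msupp f) (msupp g).
have le2 := fsubsetUr (msupp f) (msupp g).
rewrite (mulw (msuppD_le f g) (fsubset_refl _)).
rewrite (mulw le1 (fsubset_refl _)) (mulw le2 (fsubset_refl _)).
rewrite -big_split /=; apply/eq_bigr => A _.
rewrite -big_split /=; apply/eq_bigr => B _.
by rewrite mcoeffD !mulrDl scalerDl.
Qed.

Lemma mulDr : right_distributive mul +%R.
Proof.
move=> h f g; have le1 := fsubsetUl (msupp f) (msupp g).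
have le2 := fsubsetUr (msupp f) (msupp g).
rewrite (mulw (fsubset_refl _) (msuppD_le f g)).
rewrite (mulw (fsubset_refl _) le1) (mulw (fsubset_refl _) le2).
rewrite -big_split /=; apply/eq_bigr => A _.
rewrite -big_split /=; apply/eq_bigr => B _.
by rewrite mcoeffD mulrDr mulrDl scalerDl.
Qed.

Lemma mulZl c f g : mul (c *: f) g = c *: mul f g.
Proof.
rewrite (mulw (msuppZ_le c f) (fsubset_refl _)) /mul scaler_sumr.
apply/eq_bigr => A _; rewrite scaler_sumr; apply/eq_bigr => B _.
by rewrite mcoeffZ scalerA !mulrA.
Qed.

Lemma mulZr c f g : mul f (c *: g) = c *: mul f g.
Proof.
rewrite (mulw (fsubset_refl _) (msuppZ_le c g)) /mul scaler_sumr.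
apply/eq_bigr => A _; rewrite scaler_sumr; apply/eq_bigr => B _.
by rewrite mcoeffZ scalerA !mulrA [mcoeff A f * c]mulrC.
Qed.

Lemma mul0l f : mul 0 f = 0.
Proof. by rewrite -[X in mul X _](scale0r 0) mulZl scale0r. Qed.

Lemma mul0r f : mul f 0 = 0.
Proof. by rewrite -[X in mul _ X](scale0r 0) mulZr scale0r. Qed.

Lemma mul_suml (I : Type) (r : seq I) (F : I -> gr) g :
  mul (\sum_(i <- r) F i) g = \sum_(i <- r) mul (F i) g.
Proof. exact: (big_morph (mul^~ g) (fun _ _ => mulDl _ _ _) (mul0l g)). Qed.

Lemma mul_sumr (I : Type) (r : seq I) (F : I -> gr) g :
  mul g (\sum_(i <- r) F i) = \sum_(i <- r) mul g (F i).
Proof. exact: (big_morph (mul g) (fun _ _ => mulDr _ _ _) (mul0r g)). Qed.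

Lemma mul_mon A B : mul (mon A) (mon B) = sgn A B *: mon (A `|` B).
Proof.
rewrite /mul !msuppU oner_eq0 !big_seq_fset1 /mon.
by rewrite !mcoeffUU !mul1r.
Qed.

Lemma grE (f : gr) : f = \sum_(A <- msupp f) mcoeff A f *: mon A.
Proof.
rewrite [LHS](monalgE f); apply/eq_bigr => A _; apply/malgP => B.
by rewrite mcoeffZ !mcoeffU mulrnAr mulr1.
Qed.

Lemma mulA : associative mul.
Proof.
move=> f g h; rewrite (grE f) (mul_suml _ _ (mul g h)) (mul_suml _ _ g) (mul_suml _ _ h).
apply/eq_bigr => A _.
rewrite !mulZl; congr (_ *: _).
rewrite (grE g) (mul_suml _ _ h) !(mul_sumr _ _ (mon A)) (mul_suml _ _ h).
apply/eq_bigr => B _.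
rewrite !mulZl !mulZr !mulZl; congr (_ *: _).
rewrite (grE h) (mul_sumr _ _ (mon B)) (mul_sumr _ _ (mon A)).
rewrite (mul_sumr _ _ (mul (mon A) (mon B))); apply/eq_bigr => C _.
rewrite !mulZr; congr (_ *: _).
by rewrite !mul_mon mulZr mulZl !mul_mon !scalerA fsetUA -sgnA.
Qed.

Lemma mul1l : left_id (mon fset0) mul.
Proof.
move=> f; rewrite {1}(grE f) mul_sumr [RHS]grE; apply/eq_bigr => A _.
by rewrite mulZr mul_mon sgn0A scale1r fset0U.
Qed.

Lemma mul1r : right_id (mon fset0) mul.
Proof.
move=> f; rewrite {1}(grE f) mul_suml [RHS]grE; apply/eq_bigr => A _.
by rewrite mulZl mul_mon sgnA0 scale1r fsetU0.
Qed.

Lemma one_neq0 : mon fset0 != 0.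
Proof.
apply/eqP => /malgP /(_ fset0) /eqP.
by rewrite mcoeffUU mcoeff0 oner_eq0.
Qed.

HB.instance Definition _ := GRing.Zmodule_isNzRing.Build gr
  mulA mul1l mul1r mulDl mulDr one_neq0.
HB.instance Definition _ := GRing.Lmodule_isLalgebra.Build k gr
  (fun c f g => esym (mulZl c f g)).
HB.instance Definition _ := GRing.Lalgebra_isAlgebra.Build k gr
  (fun c f g => esym (mulZr c f g)).

Definition gen (i : nat) : gr := mon [fset i].

Lemma mon_mul A B : mon A * mon B = sgn A B *: mon (A `|` B).
Proof. exact: mul_mon. Qed.

Lemma inv1 i j : inv [fset i] [fset j] = (j < i)%N.
Proof. by rewrite /inv !big_seq_fset1. Qed.

Lemma gen_sq i : gen i * gen i = 0.
Proof. by rewrite mon_mul /sgn fdisjointX1 inE eqxx scale0r. Qed.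

Lemma gen_anti i j : gen i * gen j = - (gen j * gen i).
Proof.
have [->|nij] := eqVneq i j; first by rewrite gen_sq oppr0.
rewrite !mon_mul fsetUC -scaleNr; congr (_ *: _).
have dij : [disjoint [fset i] & [fset j]]%fset by rewrite fdisjointX1 inE eq_sym.
rewrite /sgn dij fdisjoint_sym dij !inv1.
by case: ltngtP nij => // _ _; rewrite expr0 expr1 ?opprK.
Qed.

Lemma gmonE s : sorted ltn s -> gmon gen s = mon [fset x in s].
Proof.
elim: s => [|i s IHs] ss.
  rewrite /gmon big_nil; congr mon.
  by apply/fsetP => x; rewrite !inE.
have ms : all (ltn i) s by apply: order_path_min ss; exact: ltn_trans.
rewrite /gmon big_cons -/(gmon gen s) IHs ?(path_sorted ss) // mon_mul.
have -> : [fset x in i :: s] = [fset i] `|` [fset x in s].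
  by apply/fsetP => x; rewrite !inE.
have is' : i \notin s by apply/negP => /(allP ms); rewrite /= ltnn.
rewrite /sgn fdisjoint1X inE is' /inv big_seq_fset1 big_seq big1 ?scale1r //.
move=> b; rewrite inE => /(allP ms) /= lt_ib.
by rewrite ltnNge ltnW.
Qed.

Lemma sorted_fset_inj s t : sorted ltn s -> sorted ltn t ->
  [fset x in s] = [fset x in t] :> {fset nat} -> s = t.
Proof.
move=> ss st /fsetP est.
apply: (irr_sorted_eq ltn_trans ltnn ss st) => x.
by have := est x; rewrite !inE.
Qed.

Lemma gen_free (S : seq (seq nat)) (c : seq nat -> k) :
  uniq S -> all (sorted ltn) S ->
  \sum_(s <- S) c s *: gmon gen s = 0 -> forall s, s \in S -> c s = 0.
Proof.
move=> uS /allP sS sum0 s sinS.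
have /malgP /(_ [fset x in s]) := sum0.
rewrite mcoeff0 raddf_sum (bigD1_seq s) //= gmonE ?sS //.
rewrite mcoeffZ mcoeffUU mulr1 big_seq_cond big1 ?addr0 // => t /andP[tS nts].
rewrite gmonE ?sS // mcoeffZ mcoeffU; case: eqP => [e|]; last by rewrite mulr0.
by case/eqP: nts; apply: sorted_fset_inj e; apply: sS.
Qed.

Lemma gen_span (x : gr) :
  exists (S : seq (seq nat)) (c : seq nat -> k),
    all (sorted ltn) S /\ x = \sum_(s <- S) c s *: gmon gen s.
Proof.
pose so (A : {fset nat}) := sort leq A.
have soP A : sorted ltn (so A).
  by rewrite ltn_sorted_uniq_leq sort_uniq fset_uniq sort_sorted //; exact: leq_total.
exists [seq so A | A <- msupp x], (fun s => mcoeff [fset x in s] x); split.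
  by apply/allP => _ /mapP[A _ ->].
rewrite big_map {1}(grE x); apply: eq_bigr => A _.
rewrite gmonE //; have -> // : [fset y in so A] = A.
by apply/fsetP => y; rewrite !inE mem_sort.
Qed.

Lemma grassmann_gr : is_grassmann gen.
Proof. exact: IsGrassmann gen_anti gen_sq gen_free gen_span. Qed.

End Model.

Lemma ex_grassmann (k : fieldType) :
  exists (G : algType k) (e : nat -> G), is_grassmann e.
Proof. by exists (gr k), (@gen k); exact: grassmann_gr. Qed.
End GrassmannModel.

Lemma grassmann_exists (k : fieldType) :
  exists (G : algType k) (e : nat -> G), is_grassmann e.
Proof. exact: GrassmannModel.ex_grassmann. Qed.

(* Main.v *)
(* The generic element x_l = sigma_l + theta_l of the Grassmann algebra, where
   theta_l is a generator and sigma_l a sum of p - 1 products of two generators,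
   behaves like a coordinate with x_l^p = 0 and differential theta_l, the
   generators of distinct blocks l being distinct.  Let B be the algebra
   generated by x_0, ..., x_(2m-1), and consider the component of top degree
   2m(2p-1) of an element of B, which is the coefficient of the product of all
   x_l^(p-1) dx_l.  It vanishes on the commutators of B: commuting two letters
   of a word costs a product of two thetas, and a word in which an odd number of
   thetas has been extracted cannot reach the top degree.

   A polynomial f with central values has, for every variable x, a cyclic
   derivative (sum of the vu over the occurrences uxv of x) that vanishes
   identically on G.  Hence the top component of sum_w c_w deg_x(w) w vanishes on
   B, and so only the words in which every letter occurs a multiple of p times
   contribute to the top component of f.  After a linear change of variables
   the letters stand for words in the x_l; a letter standing for a product of two
   nilpotent elements kills the words in which it occurs p times, so a word of
   fewer than 2m letters misses some x_l and has no top component.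

   Thus the polynomials whose top component vanishes under all substitutions, for
   all m > N, form an increasing sequence of T-spaces exhausting CP(G), while the
   central polynomial prod_(i < m) [x_2i, x_(2i+1)] x_2i^(p-1) x_(2i+1)^(p-1)
   has a nonzero top component. *)

Require Import Defs.
From HB Require Import structures.
From mathcomp Require Import all_boot all_order all_algebra.
From mathcomp Require Import finmap.
From mathcomp Require Import boolp classical_sets cardinality.
From mathcomp Require Import monalg.
From mathcomp Require Import zify.

Set Implicit Arguments.
Unset Strict Implicit.
Unset Printing Implicit Defensive.

Import GRing.Theory.

Local Open Scope ring_scope.

(** * Polynomials as lists of weighted words *)

Section Words.

Variables (k : fieldType) (A : algType k).
Implicit Types (h : nat -> A) (s t w : seq nat) (L : seq (k * seq nat)).
Implicit Types (P Q R : pred (seq nat)) (x y z : A).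

Lemma gmon_nil h : gmon h [::] = 1.
Proof. exact: big_nil. Qed.

Lemma gmon_cons h i s : gmon h (i :: s) = h i * gmon h s.
Proof. exact: big_cons. Qed.

Lemma gmon_cat h s t : gmon h (s ++ t) = gmon h s * gmon h t.
Proof. exact: big_cat. Qed.

Lemma gmon_seq1 h i : gmon h [:: i] = h i.
Proof. exact: big_seq1. Qed.

Lemma gmon_flatten h (v : nat -> seq nat) s :
  gmon (fun j => gmon h (v j)) s = gmon h (flatten (map v s)).
Proof.
by elim: s => [|i s IH] /=; rewrite ?gmon_nil // gmon_cons gmon_cat IH.
Qed.

Definition ev h L : A := \sum_(a <- L) a.1 *: gmon h a.2.

Lemma ev_nil h : ev h [::] = 0.
Proof. exact: big_nil. Qed.

Lemma ev_cons h a L : ev h (a :: L) = a.1 *: gmon h a.2 + ev h L.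
Proof. exact: big_cons. Qed.

Lemma ev_cat h L1 L2 : ev h (L1 ++ L2) = ev h L1 + ev h L2.
Proof. exact: big_cat. Qed.

Definition span h P x := exists2 L, all (fun a => P a.2) L & x = ev h L.

Lemma span_ind h P (K : A -> Prop) :
  K 0 -> (forall c s x, P s -> K x -> K (c *: gmon h s + x)) ->
  forall x, span h P x -> K x.
Proof.
move=> K0 KD x [L + ->]; elim: L => [|a L IH] /=; first by rewrite ev_nil.
by case/andP=> Pa PL; rewrite ev_cons; apply: KD (IH PL).
Qed.

Lemma span0 h P : span h P 0.
Proof. by exists [::]; rewrite ?ev_nil. Qed.

Lemma spanD h P x y : span h P x -> span h P y -> span h P (x + y).
Proof.
move=> [L1 P1 ->] [L2 P2 ->]; exists (L1 ++ L2); last by rewrite ev_cat.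
by rewrite all_cat P1.
Qed.

Lemma span_gmon h P s : P s -> span h P (gmon h s).
Proof.
by move=> Ps; exists [:: (1, s)]; rewrite /= ?Ps // /ev big_seq1 scale1r.
Qed.

Lemma spanZ h P c x : span h P x -> span h P (c *: x).
Proof.
move: x; apply: span_ind => [|d s y Ps IH]; first by rewrite scaler0; exact: span0.
rewrite scalerDr scalerA; apply: spanD IH.
exists [:: (c * d, s)]; first by rewrite /= Ps.
by rewrite /ev big_seq1.
Qed.

Lemma spanN h P x : span h P x -> span h P (- x).
Proof. by rewrite -scaleN1r; apply: spanZ. Qed.

Lemma spanB h P x y : span h P x -> span h P y -> span h P (x - y).
Proof. by move=> Px /spanN; apply: spanD. Qed.

Lemma spanS h P Q x : (forall s, P s -> Q s) -> span h P x -> span h Q x.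
Proof.
by move=> PQ [L PL ->]; exists L => //; apply: sub_all PL => a; apply: PQ.
Qed.

Lemma spanM h P Q R x y : (forall s t, P s -> Q t -> R (s ++ t)) ->
  span h P x -> span h Q y -> span h R (x * y).
Proof.
move=> PQR Px Qy; move: x Px; apply: span_ind => [|c s x Ps IH].
  by rewrite mul0r; exact: span0.
rewrite mulrDl -scalerAl; apply: spanD IH; apply: spanZ.
move: y Qy; apply: span_ind => [|d t y Qt IH].
  by rewrite mulr0; exact: span0.
rewrite mulrDr -scalerAr -gmon_cat; apply: spanD IH; apply/spanZ/span_gmon.
exact: PQR.
Qed.

Lemma span_sum h P (I : eqType) (r : seq I) (F : I -> A) :
  (forall i, i \in r -> span h P (F i)) -> span h P (\sum_(i <- r) F i).
Proof.
move=> PF; rewrite big_seq; apply: (big_ind (span h P)) PF.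
  exact: span0.
exact: spanD.
Qed.

End Words.

(** * Parity, degree and torsion in the Grassmann algebra *)

Section Grassmann.

Variables (k : fieldType) (A : algType k) (e : nat -> A).
Hypotheses (Ge : is_grassmann e) (k2 : 2%:R != 0 :> k).
Implicit Types (s t : seq nat) (x y z : A).

Definition even_elt := span e (fun s => ~~ odd (size s)).
Definition odd_elt := span e (fun s => odd (size s)).
Definition deg_le n := span e (fun s => size s <= n)%N.

Lemma gen_gmonC i s :
  e i * gmon e s = (-1) ^+ size s *: (gmon e s * e i).
Proof.
elim: s => [|j s IH]; first by rewrite gmon_nil mulr1 mul1r scale1r.
rewrite gmon_cons mulrA (grassmann_anti Ge) mulNr -[e j * e i * _]mulrA IH.
rewrite -scalerAr mulrA.
by rewrite -scaleNr -mulN1r -exprS.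
Qed.

Lemma gmonC s t :
  gmon e s * gmon e t = (-1) ^+ (size s * size t) *: (gmon e t * gmon e s).
Proof.
elim: s => [|i s IH]; first by rewrite gmon_nil mulr1 mul1r scale1r.
rewrite gmon_cons -mulrA IH -scalerAr.
rewrite [e i * (_ * _)]mulrA gen_gmonC -scalerAl -mulrA scalerA.
by rewrite -exprD addnC mulSn.
Qed.

Lemma span_all x : span e xpredT x.
Proof.
have [S [c [_ ->]]] := grassmann_span Ge x.
by apply: span_sum => s _; apply/spanZ/span_gmon.
Qed.

Lemma even_eltC x y : even_elt x -> x * y = y * x.
Proof.
move: y (span_all y); apply: span_ind => [|c s y _ IH] Ex.
  by rewrite mul0r mulr0.
rewrite mulrDr mulrDl (IH Ex) -scalerAl -scalerAr; congr (_ *: _ + _).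
move: x Ex {IH}; apply: span_ind => [|d t x Et IH]; first by rewrite mul0r mulr0.
rewrite mulrDl mulrDr IH -scalerAl -scalerAr gmonC -signr_odd oddM.
by rewrite (negPf Et) expr0 scale1r.
Qed.

Lemma odd_eltC x y : odd_elt x -> odd_elt y -> x * y = - (y * x).
Proof.
move=> + Oy; move: x; apply: span_ind => [|c s x Os IH].
  by rewrite mul0r mulr0 oppr0.
rewrite mulrDl mulrDr IH -scalerAl -scalerAr opprD -scalerN; congr (_ *: _ + _).
move: y Oy {IH}; apply: span_ind => [|d t y Ot IH].
  by rewrite mul0r mulr0 oppr0.
rewrite mulrDl mulrDr IH -scalerAl -scalerAr opprD -scalerN gmonC -signr_odd.
by rewrite oddM Os Ot expr1 scaleN1r.
Qed.

Lemma two_inj x : x + x = 0 -> x = 0.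
Proof.
rewrite -mulr2n -scaler_nat => /eqP; rewrite scaler_eq0 (negPf k2) /=.
by move/eqP.
Qed.

Lemma odd_elt_sq x : odd_elt x -> x * x = 0.
Proof.
by move=> Ox; apply: two_inj; rewrite {1}(odd_eltC Ox Ox) addNr.
Qed.

Lemma gen_sandwich i x : e i * x * e i = 0.
Proof.
move: x (span_all x); apply: span_ind => [|c s x _ IH].
  by rewrite mulr0 mul0r.
rewrite mulrDr mulrDl IH addr0 -scalerAr -scalerAl gen_gmonC -scalerAl -mulrA.
by rewrite (grassmann_sq Ge) mulr0 !scaler0.
Qed.

Lemma even_odd_split x : exists x0 x1,
  [/\ even_elt x0, odd_elt x1 & x = x0 + x1].
Proof.
move: x (span_all x); apply: span_ind => [|c s x _ [x0 [x1 [E0 O1 ->]]]].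
  by exists 0, 0; split; rewrite ?addr0 //; apply: span0.
have [Os|Es] := boolP (odd (size s)).
  exists x0, (c *: gmon e s + x1); split=> //; last by rewrite addrCA.
  by apply: spanD O1; apply/spanZ/span_gmon.
exists (c *: gmon e s + x0), x1; split=> //; last by rewrite addrA.
by apply: spanD E0; apply/spanZ/span_gmon.
Qed.

Lemma even_eltM x y : even_elt x -> even_elt y -> even_elt (x * y).
Proof.
by apply: spanM => s t Es Et; rewrite size_cat oddD (negPf Es) (negPf Et).
Qed.

Lemma odd_eltM x y : odd_elt x -> odd_elt y -> even_elt (x * y).
Proof. by apply: spanM => s t Es Et; rewrite size_cat oddD Es Et. Qed.

Lemma even_oddM x y : even_elt x -> odd_elt y -> odd_elt (x * y).
Proof. by apply: spanM => s t Es Et; rewrite size_cat oddD Et (negPf Es). Qed.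

Lemma odd_evenM x y : odd_elt x -> even_elt y -> odd_elt (x * y).
Proof. by apply: spanM => s t Es Et; rewrite size_cat oddD Es (negPf Et). Qed.

Lemma even_elt1 : even_elt 1.
Proof. by rewrite -(gmon_nil e); apply: span_gmon. Qed.

Lemma even_eltX x n : even_elt x -> even_elt (x ^+ n).
Proof.
move=> Ex; elim: n => [|n IH]; first exact: even_elt1.
by rewrite exprS; apply: even_eltM.
Qed.

Lemma odd_gen i : odd_elt (e i).
Proof. by rewrite -(gmon_seq1 e); apply: span_gmon. Qed.

Lemma deg_leM m n x y : deg_le m x -> deg_le n y -> deg_le (m + n) (x * y).
Proof. by apply: spanM => s t Es Et; rewrite size_cat leq_add. Qed.

Lemma deg_le_trans m n x : (m <= n)%N -> deg_le m x -> deg_le n x.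
Proof. by move=> mn; apply: spanS => s /leq_trans; apply. Qed.

Lemma deg_leX n x m : deg_le n x -> deg_le (m * n) (x ^+ m).
Proof.
move=> nx; elim: m => [|m IH]; last by rewrite exprS mulSn; apply: deg_leM.
by rewrite expr0 -(gmon_nil e); apply: span_gmon.
Qed.

Lemma gmon_perm s t : perm_eq s t ->
  exists b : bool, gmon e s = (-1) ^+ b *: gmon e t.
Proof.
elim: s t => [|i s IH] t.
  by rewrite perm_sym => /perm_nilP ->; exists false; rewrite scale1r.
move=> pst; have it : i \in t by rewrite -(perm_mem pst) mem_head.
case/splitPr: it pst => t1 t2; rewrite perm_sym -cat1s perm_catCA /= perm_cons.
rewrite perm_sym => /IH[b Eb].
exists (odd (b + size t1)); rewrite signr_odd gmon_cons Eb -scalerAr.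
rewrite gmon_cat mulrA gen_gmonC -scalerAl scalerA -exprD -mulrA -gmon_cons.
by rewrite -gmon_cat.
Qed.

Lemma gmon_nuniq s : ~~ uniq s -> gmon e s = 0.
Proof.
elim: s => //= i s IH; rewrite negb_and negbK => /orP[/splitPr|/IH ns].
  case=> s1 s2; rewrite gmon_cons gmon_cat gmon_cons !mulrA gen_sandwich.
  by rewrite mul0r.
by rewrite gmon_cons ns mulr0.
Qed.

(* Words are sorted up to sign, and those sharing a word are merged. *)
Lemma span_sorted (P : pred (seq nat)) x :
  (forall s t, perm_eq s t -> P s -> P t) -> span e P x ->
  exists (S : seq (seq nat)) (c : seq nat -> k),
    [/\ uniq S, all (sorted ltn) S, all P S & x = \sum_(s <- S) c s *: gmon e s].
Proof.
move=> Pperm; move: x; apply: span_ind => [|c s x Ps [S [d [uS sS PS ->]]]].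
  by exists [::], (fun=> 0); rewrite big_nil.
have [us|nus] := boolP (uniq s); last first.
  by exists S, d; rewrite gmon_nuniq // scaler0 add0r.
have pst : perm_eq s (sort leq s) by rewrite perm_sym perm_sort.
have [b ->] := gmon_perm pst; set t := sort leq s in pst *.
have st : sorted ltn t.
  by rewrite ltn_sorted_uniq_leq sort_uniq us sort_sorted //; apply: leq_total.
rewrite scalerA; set c' := c * _.
have [tS|ntS] := boolP (t \in S).
  exists S, (fun u => d u + c' *+ (u == t)); split=> //.
  rewrite (bigD1_seq t) //= [RHS](bigD1_seq t) //= addrA -scalerDl eqxx addrC.
  rewrite [in RHS]addrC [d t + _]addrC; congr (_ + _).
  by apply: eq_bigr => u /negPf ->; rewrite addr0.
exists (t :: S), (fun u => if u == t then c' else d u); split=> /=.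
- by rewrite ntS.
- by rewrite st.
- by rewrite (Pperm s).
rewrite big_cons eqxx; congr (_ + _); apply: eq_big_seq => u uS'.
by case: eqP => // ut; rewrite -ut uS' in ntS.
Qed.

(** The sorted form of [s] is longer than every word of such an expansion, so a nontrivial relation
    between distinct basis elements would result. *)
Lemma gmon_top_deg_le s n : uniq s -> (n < size s)%N ->
  ~ deg_le n (gmon e s).
Proof.
move=> us ns Ds.
have [|S [c [uS sS DS Es]]] := span_sorted _ Ds.
  by move=> t u /perm_size ->.
have pst : perm_eq s (sort leq s) by rewrite perm_sym perm_sort.
have [b Eb] := gmon_perm pst; set t := sort leq s in pst Eb *.
have st : sorted ltn t.
  by rewrite ltn_sorted_uniq_leq sort_uniq us sort_sorted //; apply: leq_total.
have ntS : t \notin S.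
  by apply/negP => /(allP DS); rewrite size_sort leqNgt ns.
have := @grassmann_free _ _ _ Ge (t :: S)
  (fun u => if u == t then (-1) ^+ b else - c u).
rewrite /= ntS st big_cons eqxx -Eb Es.
have -> : \sum_(j <- S) (if j == t then (-1) ^+ b else - c j) *: gmon e j =
  - \sum_(s <- S) c s *: gmon e s.
  rewrite -sumrN; apply: eq_big_seq => u uS'; case: eqP => [ut|_].
    by rewrite -ut uS' in ntS.
  by rewrite scaleNr.
rewrite subrr => /(_ uS sS erefl t); rewrite mem_head eqxx => /(_ isT)/eqP.
by rewrite signr_eq0.
Qed.

(** Right multiplication by a generator beyond all indices of [x] sends its sorted words to distinct
    sorted words. *)
Lemma gen_torsion_free x : (forall i, x * e i = 0) -> x = 0.
Proof.
move=> x0; have [//|S [c [uS sS _ Ex]]] := span_sorted _ (span_all x).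
pose j := (\max_(i <- flatten S) i).+1.
have ltj s i : s \in S -> i \in s -> (i < j)%N.
  move=> sS' si; rewrite ltnS; apply: leq_bigmax_seq => //.
  by apply/flattenP; exists s.
rewrite Ex big_seq big1 // => s sS'.
have := @grassmann_free _ _ _ Ge (map (rcons^~ j) S) (fun t => c (take (size t).-1 t)).
rewrite map_inj_uniq; last exact: rcons_injl.
move/(_ uS); rewrite big_map.
have -> : all (sorted ltn) [seq rcons i j | i <- S].
  apply/allP => _ /mapP[t tS ->]; have := allP sS t tS.
  case: t tS => //= i t tS pt; rewrite rcons_path pt /=.
  by apply: ltj tS _; apply: mem_last.
have Et t : take (size (rcons t j)).-1 (rcons t j) = t.
  by rewrite size_rcons /= -cats1 take_size_cat.
have -> : \sum_(t <- S) c (take (size (rcons t j)).-1 (rcons t j)) *: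
    gmon e (rcons t j) = x * e j.
  rewrite Ex mulr_suml; apply: eq_bigr => t _.
  by rewrite Et -cats1 gmon_cat gmon_seq1 scalerAl.
rewrite x0 => /(_ isT erefl (rcons s j)); rewrite Et => -> //.
  by rewrite scale0r.
exact: map_f.
Qed.

(** Moving [e i] to the right gives [x0 * e i = x1 * e i]. So [x0 = x1] is both even and odd: it
    commutes and anticommutes with every generator. *)
Lemma gen_torsion_freel x : (forall i, e i * x = 0) -> x = 0.
Proof.
have [x0 [x1 [E0 O1 ->]]] := even_odd_split x => H.
have eq01 i : x0 * e i = x1 * e i.
  have := H i; rewrite mulrDr (odd_eltC (odd_gen i) O1) -even_eltC //.
  by move/subr0_eq.
have x01 : x0 - x1 = 0.
  by apply: gen_torsion_free => i; rewrite mulrBl eq01 subrr.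
have E1 : even_elt x1 by rewrite -(subr0_eq x01).
have x10 : x1 = 0.
  apply: gen_torsion_free => i; apply: two_inj.
  by rewrite {1}(even_eltC _ E1) (odd_eltC (odd_gen i) O1) addNr.
by move: x01; rewrite x10 subr0 addr0.
Qed.

Lemma central_odd_part x0 x1 : even_elt x0 -> odd_elt x1 ->
  @centre A (x0 + x1) -> x1 = 0.
Proof.
move=> E0 O1 Cx; apply: gen_torsion_free => i; apply: two_inj.
have := Cx (e i); rewrite /GRing.comm mulrDl mulrDr -(even_eltC _ E0).
move/addrI; rewrite (odd_eltC (odd_gen i) O1) => {2}->.
by rewrite addrN.
Qed.

End Grassmann.

(** * Truncated coordinates in the Grassmann algebra *)

Section Blocks.

Variables (k : fieldType) (A : algType k) (e : nat -> A) (p m : nat).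
Hypotheses (Ge : is_grassmann e) (pk : p \in [pchar k]) (p_gt2 : (2 < p)%N).
Implicit Types (J s t u v w : seq nat) (x y z : A) (c : k).

Local Notation even_elt := (even_elt e).
Local Notation odd_elt := (odd_elt e).
Local Notation deg_le := (deg_le e).

Lemma two_neq0 : 2%:R != 0 :> k.
Proof. by rewrite -(dvdn_pcharf pk) gtnNdvd. Qed.
Let k2 := two_neq0.

Lemma pchar_alg : p \in [pchar A].
Proof.
rewrite inE (pcharf_prime pk) /=; apply/eqP.
by rewrite -[p%:R]scaler_nat (pcharf0 pk) scale0r.
Qed.

Lemma pfrobD x y : x * y = y * x -> (x + y) ^+ p = x ^+ p + y ^+ p.
Proof. exact: (pFrobenius_autD_comm pchar_alg). Qed.

Lemma pexp_sum0 (I : Type) (r : seq I) (F : I -> A) :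
  (forall i, even_elt (F i)) -> (forall i, F i ^+ p = 0) ->
  (\sum_(i <- r) F i) ^+ p = 0.
Proof.
have p_gt0 := ltn_trans (ltn0Sn 1) p_gt2.
move=> EF F0; elim: r => [|i r IH]; first by rewrite big_nil expr0n gtn_eqF.
rewrite big_cons pfrobD; last exact: even_eltC (EF i).
by rewrite F0 IH addr0.
Qed.

Lemma sq0_exp x n : (1 < n)%N -> x * x = 0 -> x ^+ n = 0.
Proof. by case: n => [|[|n]] // _ x2; rewrite 2!exprS mulrA x2 mul0r. Qed.

Lemma p_gt1 : (1 < p)%N. Proof. exact: ltnW. Qed.

(* Block l consists of the p.*2.-1 generators from e (l * p.*2.-1) on; outside the
   m.*2 blocks everything is 0. *)
Definition theta l := if (l < m.*2)%N then e (l * p.*2.-1) else 0.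

Definition genpair l j := e (l * p.*2.-1 + j.*2.+1) * e (l * p.*2.-1 + j.*2.+2).

Definition sigma l := if (l < m.*2)%N then \sum_(j < p.-1) genpair l j else 0.

(** The scalar [c] will be 1 or -1: carrying a theta across a word flips the sign of the odd part of
    each letter. *)
Definition xval c l := sigma l + c *: theta l.

Lemma even_pair l j : even_elt (genpair l j).
Proof. by apply: odd_eltM; apply: odd_gen. Qed.

Lemma pair_sq l j : genpair l j * genpair l j = 0.
Proof. by rewrite /genpair mulrA gen_sandwich // mul0r. Qed.

Lemma even_sigma l : even_elt (sigma l).
Proof.
rewrite /sigma; case: ifP => _; last exact: span0.
by apply: span_sum => j _; apply: even_pair.
Qed.

Lemma odd_theta l : odd_elt (theta l).
Proof. by rewrite /theta; case: ifP => _; [apply: odd_gen | apply: span0]. Qed.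

Lemma oddZ c x : odd_elt x -> odd_elt (c *: x). Proof. exact: spanZ. Qed.

Lemma theta_sq l : theta l * theta l = 0.
Proof. exact: odd_elt_sq (odd_theta l). Qed.

Lemma sigma_pexp l : sigma l ^+ p = 0.
Proof.
rewrite /sigma; case: ifP => _.
  apply: pexp_sum0 => j; first exact: even_pair.
  exact: sq0_exp p_gt1 (pair_sq _ _).
by rewrite expr0n gtn_eqF // ltnW // p_gt1.
Qed.

Lemma xval_pexp c l : xval c l ^+ p = 0.
Proof.
rewrite /xval pfrobD ?sigma_pexp ?add0r; last exact: even_eltC (even_sigma l).
apply: sq0_exp p_gt1 _.
by rewrite -scalerAl -scalerAr theta_sq !scaler0.
Qed.

Lemma deg_xval c l : deg_le 2 (xval c l).
Proof.
apply: spanD.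
  rewrite /sigma; case: ifP => _; last exact: span0.
  apply: span_sum => j _.
  by rewrite /genpair -[X in _ * X]gmon_seq1 -gmon_cons; apply: span_gmon.
apply: spanZ; rewrite /theta; case: ifP => _; last exact: span0.
by rewrite -gmon_seq1; apply: span_gmon.
Qed.

Lemma deg_xval_exp c l n : deg_le p.-1.*2 (xval c l ^+ n).
Proof.
have [np|pn] := ltnP n p; last first.
  by rewrite -(subnKC pn) exprD xval_pexp mul0r; apply: span0.
apply: deg_le_trans (deg_leX n (deg_xval c l)).
by rewrite muln2 leq_double -ltnS prednK // ltnW // p_gt1.
Qed.

Lemma xval_out c l : (m.*2 <= l)%N -> xval c l = 0.
Proof.
by move=> ml; rewrite /xval /sigma /theta ltnNge ml scaler0 addr0.
Qed.

Lemma comm_odd_part x0 x1 y0 y1 : even_elt x0 -> odd_elt x1 ->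
  even_elt y0 -> odd_elt y1 ->
  (x0 + x1) * (y0 + y1) - (y0 + y1) * (x0 + x1) = (x1 * y1) *+ 2.
Proof.
move=> Ex Ox Ey Oy; rewrite mulrDl [(y0 + y1) * _]mulrDr (even_eltC Ge (y0 + y1) Ex).
rewrite opprD addrACA subrr add0r mulrDr mulrDl (even_eltC Ge x1 Ey).
by rewrite opprD addrACA subrr add0r (odd_eltC Ge Oy Ox) opprK.
Qed.

Lemma xval_comm c a b : xval c a * xval c b - xval c b * xval c a =
  (c ^+ 2 *+ 2) *: (theta a * theta b).
Proof.
have O l := oddZ c (odd_theta l).
rewrite (comm_odd_part (even_sigma a) (O a) (even_sigma b) (O b)).
by rewrite -scalerAl -scalerAr scalerA -expr2 scalerMnl.
Qed.

(* For m > 0 the bound is one less than the number m.*2 * p.*2.-1 of generators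
   occurring in the blocks. *)
Definition low := deg_le (m.*2 * p.-1.*2 + m.*2.-1).

(** [J] lists the thetas already extracted and [w] the letters left. Top degree will force all
    [m.*2] thetas into [J], which extraction in pairs cannot achieve from here. *)
Definition deficient J w :=
  odd (size J) || has (fun l => l \notin J ++ w) (iota 0 m.*2).

Lemma deficientS J w J' w' : (odd (size J) -> odd (size J')) ->
  {subset J' ++ w' <= J ++ w} -> deficient J w -> deficient J' w'.
Proof.
move=> oJ sub /orP[/oJ o|h]; apply/orP; first by left.
by right; apply: sub_has h => l; apply: contra => /sub.
Qed.

Lemma theta_gmon_deg J : deg_le (size J) (gmon theta J).
Proof.
elim: J => [|l J IH]; first by rewrite gmon_nil -(gmon_nil e); apply: span_gmon.
rewrite gmon_cons -[size _]/(1 + size J)%N; apply: deg_leM IH.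
rewrite /theta; case: ifP => _; last exact: span0.
by rewrite -gmon_seq1; apply: span_gmon.
Qed.

Lemma theta_gmon_nuniq J : ~~ uniq J -> gmon theta J = 0.
Proof.
elim: J => //= i s IH; rewrite negb_and negbK => /orP[/splitPr|/IH ns].
  case=> s1 s2; rewrite gmon_cons gmon_cat gmon_cons !mulrA.
  suff -> : theta i * gmon theta s1 * theta i = 0 by rewrite mul0r.
  by rewrite /theta; case: ifP => _; rewrite ?gen_sandwich ?mul0r.
by rewrite gmon_cons ns mulr0.
Qed.

Lemma theta_gmon_out J l : l \in J -> (m.*2 <= l)%N -> gmon theta J = 0.
Proof.
move=> /splitPr[s t] ml.
by rewrite gmon_cat gmon_cons /theta ltnNge ml mul0r mulr0.
Qed.

Lemma deficient_deg c J w : deficient J w ->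
  deg_le (m.*2 * p.-1.*2 + size J) (gmon theta J * gmon (xval c) w) ->
  low (gmon theta J * gmon (xval c) w).
Proof.
move=> dw; have dJ : deficient J [::].
  apply: deficientS dw => // l.
  by rewrite cats0 mem_cat => ->.
have [uJ|nuJ] := boolP (uniq J); last first.
  by rewrite theta_gmon_nuniq // mul0r => _; apply: span0.
have [sJ|] := boolP (all (fun l => l < m.*2)%N J); last first.
  case/allPn => l lJ; rewrite -leqNgt => ml.
  by rewrite (theta_gmon_out lJ ml) mul0r => _; apply: span0.
have subJ : {subset J <= iota 0 m.*2}.
  by move=> l /(allP sJ); rewrite mem_iota.
have := uniq_leq_size uJ subJ; rewrite size_iota => leJ.
apply: deg_le_trans; rewrite leq_add2l.
(* A duplicate-free [J] within range has length [m.*2] only if it contains every index; parity or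
   the missing letter excludes this. *)
suff : size J != m.*2.
  move: leJ; rewrite leq_eqVlt => /orP[/eqP->|lt _]; first by rewrite eqxx.
  by rewrite -ltnS prednK // (leq_ltn_trans _ lt).
case/orP: dJ => [oJ|]; first by apply: contraL oJ => /eqP ->; rewrite odd_double.
rewrite cats0 => /hasP[l l2 lJ]; apply: contra lJ => /eqP sJ2.
have [] := uniq_min_size uJ subJ; first by rewrite size_iota sJ2.
by move=> _ ->.
Qed.

Lemma theta_pairC x a b : x * (theta a * theta b) = theta a * theta b * x.
Proof.
by apply/esym/(even_eltC Ge)/odd_eltM; apply: odd_theta.
Qed.

Section Permutation.

Variables (c : k) (n : nat).
Hypothesis IHn : forall J w, (size w < n)%N -> deficient J w ->
  low (gmon theta J * gmon (xval c) w).

(** The commutator of two letters is a multiple of [theta a * theta b], which is central and joins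
    [J]. The word gets shorter, while the parity of [J] and the set of all letters are unchanged, so
    [IHn] applies. *)
Lemma low_swap J r v a b : (size (r ++ a :: b :: v) <= n)%N ->
  deficient J (r ++ a :: b :: v) ->
  low (gmon theta J *
    (gmon (xval c) (r ++ a :: b :: v) - gmon (xval c) (r ++ b :: a :: v))).
Proof.
move=> sz dJ; rewrite !gmon_cat !gmon_cons -mulrBr.
rewrite ![xval _ _ * (xval _ _ * _)]mulrA -mulrBl xval_comm.
rewrite -scalerAl -!scalerAr; apply: spanZ.
rewrite [gmon _ r * _]mulrA theta_pairC -mulrA -gmon_cat !mulrA.
have -> : gmon theta J * theta a * theta b = gmon theta (J ++ [:: a; b]).
  by rewrite gmon_cat gmon_cons gmon_seq1 mulrA.
apply: IHn.
  by move: sz; rewrite !size_cat /=; lia.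
apply: deficientS dJ; first by rewrite size_cat oddD /= addbF.
move=> l; rewrite !(mem_cat, inE) -!orbA.
by do ![case: (_ == _) => //=; rewrite ?orbT //]; do ![case: (_ \in _) => //=].
Qed.

Lemma low_insert J r u v a : (size (r ++ a :: u ++ v) <= n)%N ->
  deficient J (r ++ a :: u ++ v) ->
  low (gmon theta J *
    (gmon (xval c) (r ++ u ++ a :: v) - gmon (xval c) (r ++ a :: u ++ v))).
Proof.
elim: u r => [|b u IHu] r sz dJ; first by rewrite subrr mulr0; apply: span0.
rewrite -[X in gmon _ X - _](cat_rcons b r) /=.
rewrite -[X in low (_ * X)](subrKA (gmon (xval c) (rcons r b ++ a :: u ++ v))).
rewrite mulrDr; apply: spanD.
  apply: IHu; first by move: sz; rewrite /= !(size_cat, size_rcons) /= ?size_cat; lia.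
  apply: deficientS dJ => // l; rewrite !(mem_cat, mem_rcons, inE).
  by do ![case: (_ == _) => //=; rewrite ?orbT //].
rewrite cat_rcons; apply: low_swap.
  by move: sz; rewrite !size_cat /= !size_cat; lia.
apply: deficientS dJ => // l; rewrite !(mem_cat, inE).
by do ![case: (_ == _) => //=; rewrite ?orbT //].
Qed.

Lemma low_perm J r s t : perm_eq s t -> (size (r ++ s) <= n)%N ->
  deficient J (r ++ s) ->
  low (gmon theta J * (gmon (xval c) (r ++ s) - gmon (xval c) (r ++ t))).
Proof.
elim: s r t => [|i s IHs] r t.
  by rewrite perm_sym => /perm_nilP -> _ _; rewrite subrr mulr0; apply: span0.
move=> pst; have it : i \in t by rewrite -(perm_mem pst) mem_head.
case/splitPr: it pst => t1 t2; rewrite perm_sym -cat1s perm_catCA /= perm_cons.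
rewrite perm_sym => pst sz dJ.
rewrite -[X in low (_ * X)](subrKA (gmon (xval c) (r ++ i :: t1 ++ t2))).
rewrite mulrDr; apply: spanD.
  by rewrite -!(cat_rcons i); apply: IHs; rewrite ?cat_rcons.
rewrite -opprB mulrN; apply: spanN; apply: low_insert.
  by move: sz; rewrite !size_cat /= (perm_size pst) size_cat.
by apply: deficientS dJ => // l; rewrite !(mem_cat, inE) (perm_mem pst) mem_cat.
Qed.

End Permutation.

(** Induction on the length of [w]: modulo shorter words, equal letters are gathered into powers.
    Each power has degree at most [p.-1.*2], and [deficient_deg] concludes. *)
Lemma low_gmon c J w : deficient J w ->
  low (gmon theta J * gmon (xval c) w).
Proof.
have [n] := ubnP (size w); elim: n J w => // n IHn J w; rewrite ltnS => sz dJ.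
have [sw|] := boolP (all (fun l => l < m.*2)%N w); last first.
  case/allPn => l /splitPr[u v]; rewrite -leqNgt => ml.
  rewrite gmon_cat gmon_cons xval_out // mul0r !mulr0; exact: span0.
pose t := flatten [seq nseq (count_mem l w) l | l <- undup w].
have pwt : perm_eq w t by rewrite perm_sym; apply: perm_count_undup.
rewrite -[gmon (xval c) w](subrK (gmon (xval c) t)) mulrDr; apply: spanD.
  exact: (@low_perm c n IHn J [::] w t).
apply: deficient_deg.
  by apply: deficientS dJ => // l; rewrite !mem_cat (perm_mem pwt).
rewrite [(_ + size J)%N]addnC; apply: deg_leM (theta_gmon_deg J) _.
apply: (@deg_le_trans _ _ _ (size (undup w) * p.-1.*2)).
  rewrite leq_mul2r -[X in (_ <= X)%N](size_iota 0 m.*2); apply/orP; right.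
  apply: uniq_leq_size (undup_uniq w) _ => l; rewrite mem_undup.
  by move/(allP sw); rewrite mem_iota.
rewrite /t; elim: (undup w) => [|l U IHU] /=.
  by rewrite gmon_nil -(gmon_nil e); apply: span_gmon.
rewrite gmon_cat mulSn; apply: deg_leM IHU.
have -> : gmon (xval c) (nseq (count_mem l w) l) = xval c l ^+ count_mem l w.
  by rewrite /gmon big_nseq -Monoid.iteropE; elim: (count_mem _ _) => //= j ->;
     rewrite exprS.
exact: deg_xval_exp.
Qed.

Lemma gmon_theta i w :
  gmon (xval 1) w * theta i = theta i * gmon (xval (-1)) w.
Proof.
elim: w => [|j w IH]; first by rewrite !gmon_nil mulr1 mul1r.
rewrite !gmon_cons -mulrA IH !mulrA; congr (_ * _).
rewrite /xval scale1r scaleN1r mulrDl mulrDr mulrN.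
rewrite (even_eltC Ge _ (even_sigma j)).
by rewrite (odd_eltC Ge (odd_theta i) (odd_theta j)) opprK.
Qed.

(** The central part [sigma i] cancels. What remains is [theta i] times a difference of two words,
    and a single extracted theta is deficient by parity. *)
Lemma low_comm1 i w :
  low (gmon (xval 1) (i :: w) - gmon (xval 1) (w ++ [:: i])).
Proof.
have Ei : xval 1 i = sigma i + theta i by rewrite /xval scale1r.
rewrite gmon_cons gmon_cat gmon_seq1 Ei mulrDl mulrDr.
rewrite (even_eltC Ge _ (even_sigma i)) opprD addrACA subrr add0r gmon_theta.
by rewrite -(gmon_seq1 theta); apply: spanB; apply: low_gmon.
Qed.

(** Letters are rotated one at a time. The top component is thus a trace on the algebra of the
    coordinates. *)
Lemma low_comm u v : low (gmon (xval 1) (u ++ v) - gmon (xval 1) (v ++ u)).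
Proof.
elim: v u => [|a v IHv] u; first by rewrite cats0 subrr; apply: span0.
have -> : u ++ a :: v = (u ++ [:: a]) ++ v by rewrite -catA.
rewrite -(subrKA (gmon (xval 1) (v ++ u ++ [:: a]))).
apply: spanD (IHv _) _.
by rewrite catA -opprB; apply/spanN/low_comm1.
Qed.

End Blocks.

(* Modulo exact forms, the value of this polynomial on two Grassmann-valued
   variables is the differential form 2 x^q dx y^q dy. *)
Definition cartier_factor (R : nzRingType) (q : nat) (x y : R) : R :=
  (x * y - y * x) * x ^+ q * y ^+ q.

Lemma rmorph_cartier_factor (R S : nzRingType) (phi : {rmorphism R -> S}) q x y :
  phi (cartier_factor q x y) = cartier_factor q (phi x) (phi y).
Proof. by rewrite /cartier_factor !rmorphM rmorphB !rmorphXn !rmorphM. Qed.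

(** * Nilpotent elements and values of the Cartier factors *)

Section CartierFactors.

Variables (k : fieldType) (A : algType k) (e : nat -> A) (p m : nat).
Hypotheses (Ge : is_grassmann e) (pk : p \in [pchar k]) (p_gt2 : (2 < p)%N).
Implicit Types (J s t u v w : seq nat) (x y z : A) (c : k).

Local Notation even_elt := (even_elt e).
Local Notation odd_elt := (odd_elt e).
Local Notation deg_le := (deg_le e).
Local Notation theta := (theta e p m).
Local Notation sigma := (sigma e p m).
Local Notation genpair := (genpair e p).
Local Notation xval := (xval e p m).
Local Notation low := (low e p m).

Let k2 := two_neq0 pk p_gt2.

Definition nilp x := exists x0 x1,
  [/\ even_elt x0, odd_elt x1, x = x0 + x1 & x0 ^+ p = 0].

Lemma mul_splitE x0 x1 y0 y1 : (x0 + x1) * (y0 + y1) =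
  (x0 * y0 + x1 * y1) + (x0 * y1 + x1 * y0).
Proof. by rewrite mulrDl !mulrDr [x1 * y0 + _]addrC addrACA. Qed.

(** On the even part [x0 * y0 + x1 * y1] the [p]-th power is additive; [x0 ^+ p = 0] and [x1 * y1]
    squares to zero. *)
Lemma nilp_mulr x y : nilp x -> nilp (x * y).
Proof.
move=> [x0 [x1 [E0 O1 -> x0p]]]; have [y0 [y1 [F0 F1 ->]]] := even_odd_split Ge y.
exists (x0 * y0 + x1 * y1), (x0 * y1 + x1 * y0); rewrite mul_splitE; split=> //.
- by apply: spanD; [apply: even_eltM | apply: odd_eltM].
- by apply: spanD; [apply: even_oddM | apply: odd_evenM].
rewrite (pfrobD pk); last exact/(even_eltC Ge)/even_eltM.
rewrite exprMn_comm; last exact: (even_eltC Ge _ _).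
rewrite x0p mul0r add0r; apply: sq0_exp; first exact: p_gt1.
rewrite mulrA -[_ * y1 * x1]mulrA (odd_eltC Ge F1 O1) mulrN mulrA.
by rewrite (odd_elt_sq Ge k2 O1) mul0r oppr0 mul0r.
Qed.

Lemma nilp_xval c l : nilp (xval c l).
Proof.
exists (sigma l), (c *: theta l); split=> //.
- exact: even_sigma.
- by apply: oddZ; apply: odd_theta.
- exact: sigma_pexp.
Qed.

(** The last equation is [h^(p-1) dh = 0] for [h = x y]: by the Leibniz rule each term contains
    [x0 ^+ p] or [y0 ^+ p]. *)
Lemma nilp_prod x y : nilp x -> nilp y -> exists h0 h1,
  [/\ even_elt h0, odd_elt h1, x * y = h0 + h1, h0 ^+ p = 0
    & h0 ^+ p.-1 * h1 = 0].
Proof.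
move=> nx; have [z0 [z1 _]] := nilp_mulr y nx.
move: nx => [x0 [x1 [E0 O1 -> x0p]]] [y0 [y1 [F0 F1 -> y0p]]].
have x11 := odd_elt_sq Ge k2 O1; have y11 := odd_elt_sq Ge k2 F1.
have E00 := even_eltM E0 F0; have E11 := odd_eltM O1 F1.
have n11 : (x1 * y1) * (x1 * y1) = 0.
  rewrite mulrA -[_ * y1 * x1]mulrA (odd_eltC Ge F1 O1) mulrN mulrA.
  by rewrite x11 mul0r oppr0 mul0r.
exists (x0 * y0 + x1 * y1), (x0 * y1 + x1 * y0); rewrite mul_splitE; split=> //.
- exact: spanD.
- by apply: spanD; [apply: even_oddM | apply: odd_evenM].
- rewrite (pfrobD pk); last exact: (even_eltC Ge _ _).
  rewrite exprMn_comm; last exact: (even_eltC Ge _ _).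
  by rewrite x0p mul0r add0r; apply: sq0_exp n11; apply: p_gt1.
set h1 := x0 * y1 + x1 * y0; set a := x0 * y0; set n := x1 * y1.
(* Each term of [h1] shares an odd factor with [n], so in front of [h1] the powers of [a + n] reduce
   to those of [a]. *)
have nh1 : n * h1 = 0.
  rewrite /h1 mulrDr (even_eltC Ge y1 E0) [n * (y1 * _)]mulrA /n.
  rewrite -[x1 * y1 * y1]mulrA y11 mulr0 mul0r add0r mulrA -[_ * y1 * x1]mulrA.
  by rewrite (odd_eltC Ge F1 O1) mulrN mulrA x11 mul0r oppr0 mul0r.
have pow q : (a + n) ^+ q * h1 = a ^+ q * h1.
  elim: q => // q IH; rewrite exprSr -mulrA mulrDl nh1 addr0.
  rewrite mulrA -(even_eltC Ge _ E00) -mulrA IH mulrA exprS.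
  by [].
rewrite pow /a exprMn_comm; last exact: (even_eltC Ge _ _).
have Sp : p.-1.+1 = p by rewrite prednK // ltnW // p_gt1.
rewrite mulrDr.
have -> : x0 ^+ p.-1 * y0 ^+ p.-1 * (x0 * y1) = 0.
  rewrite mulrA -(even_eltC Ge _ E0) !mulrA -exprS Sp x0p !mul0r.
  by [].
have -> : x0 ^+ p.-1 * y0 ^+ p.-1 * (x1 * y0) = 0.
  rewrite -(even_eltC Ge x1 F0) -mulrA [y0 ^+ _ * _]mulrA -exprSr Sp y0p mul0r.
  by rewrite mulr0.
by rewrite addr0.
Qed.

Lemma exprD_sq0 x y n : x * y = y * x -> y * y = 0 ->
  (x + y) ^+ n.+1 = x ^+ n.+1 + (x ^+ n * y) *+ n.+1.
Proof.
move=> xy yy; elim: n => [|n IH]; first by rewrite !expr1 expr0 mul1r.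
rewrite exprSr IH mulrDr !mulrDl !mulrnAl -!exprSr -!mulrA yy mulr0 mul0rn addr0.
by rewrite -xy [x ^+ n * _]mulrA -exprSr -addrA -mulrSr.
Qed.

Lemma odd_skip h1 x : odd_elt h1 -> exists y, h1 * x = y * h1.
Proof.
move=> O1; have [x0 [x1 [E0 F1 ->]]] := even_odd_split Ge x; exists (x0 - x1).
by rewrite mulrDr -(even_eltC Ge h1 E0) (odd_eltC Ge O1 F1) mulrBl.
Qed.

(** The contributions of the letter [j] are collected in front, where the odd part can be chosen
    only once because [h1] squares to zero. So [p] occurrences produce [h0 ^+ p] or
    [h0 ^+ p.-1 * h1]. *)
Lemma gmon_vanish (h : nat -> A) j h0 h1 w :
  even_elt h0 -> odd_elt h1 -> h j = h0 + h1 ->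
  h0 ^+ p = 0 -> h0 ^+ p.-1 * h1 = 0 -> (p <= count_mem j w)%N -> gmon h w = 0.
Proof.
move=> E0 O1 hj h0p h0h1.
have Ea a := even_eltX a E0.
have odd0 a s : (p.-1 <= a + count_mem j s)%N -> h0 ^+ a * (h1 * gmon h s) = 0.
  elim: s a => [|i s IH] a /=.
    rewrite addn0 => /subnK <-.
    by rewrite gmon_nil mulr1 exprD -mulrA h0h1 mulr0.
  rewrite gmon_cons; case: eqP => [->|_] sz.
    rewrite hj mulrDl mulrDr [h1 * (h1 * _)]mulrA (odd_elt_sq Ge k2 O1) mul0r.
    rewrite addr0 [h1 * (h0 * _)]mulrA -(even_eltC Ge h1 E0) -mulrA.
    rewrite [h0 ^+ a * _]mulrA -exprSr.
    by apply: IH; rewrite addSn -addnS.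
  have [y hy] := odd_skip (h i) O1.
  by rewrite [h1 * _]mulrA hy -mulrA mulrA (even_eltC Ge y (Ea a)) -mulrA IH ?mulr0.
have even0 a s : (p <= a + count_mem j s)%N -> h0 ^+ a * gmon h s = 0.
  elim: s a => [|i s IH] a /=.
    by rewrite addn0 => /subnK <-; rewrite exprD h0p mulr0 mul0r.
  rewrite gmon_cons; case: eqP => [->|_] sz.
    rewrite hj mulrDl mulrDr [_ ^+ a * (h0 * _)]mulrA -exprSr IH ?odd0 ?addr0 //.
      by move: sz; rewrite add1n addnS; case: (p).
    by rewrite addSn -addnS.
  by rewrite mulrA (even_eltC Ge (h i) (Ea a)) -mulrA IH ?mulr0.
by move=> pw; have := even0 0%N w pw; rewrite expr0 mul1r.
Qed.

Lemma expr_absorb_odd b z0 z1 q : even_elt z0 -> b * z1 = 0 ->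
  b * (z0 + z1) ^+ q = b * z0 ^+ q.
Proof.
move=> E0 bz; elim: q => // q IH; rewrite !exprSr !mulrA IH mulrDr.
by rewrite -[_ * z1]mulrA (even_eltC Ge z1 (even_eltX q E0)) mulrA bz mul0r addr0.
Qed.

Lemma cartier_factorE x0 x1 y0 y1 q : even_elt x0 -> odd_elt x1 ->
  even_elt y0 -> odd_elt y1 ->
  cartier_factor q (x0 + x1) (y0 + y1) = (x1 * y1 * x0 ^+ q * y0 ^+ q) *+ 2.
Proof.
move=> Ex Ox Ey Oy; rewrite /cartier_factor (comm_odd_part Ge Ex Ox Ey Oy) !mulrnAl.
have x11 := odd_elt_sq Ge k2 Ox; have y11 := odd_elt_sq Ge k2 Oy.
congr (_ *+ 2); rewrite [x1 * y1 * (_ + _) ^+ _]expr_absorb_odd //; last first.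
  by rewrite -mulrA (odd_eltC Ge Oy Ox) mulrN mulrA x11 mul0r oppr0.
rewrite expr_absorb_odd // -mulrA (even_eltC Ge y1 (even_eltX q Ex)) mulrA.
by rewrite -[_ * y1 * y1]mulrA y11 mulr0 mul0r.
Qed.

(** The vanishing of the next power serves the induction: it removes the term of the expansion that
    lacks [F n]. *)
Lemma sum_sq0_exp (F : nat -> A) n : (forall i, even_elt (F i)) ->
  (forall i, F i * F i = 0) ->
  (\sum_(i < n) F i) ^+ n = (\prod_(i < n) F i) *+ n`! /\
  (\sum_(i < n) F i) ^+ n.+1 = 0.
Proof.
move=> EF F0; elim: n => [|n [IH1 IH2]].
  by rewrite !big_ord0 expr0 fact0 expr1.
have C : (\sum_(i < n) F i) * F n = F n * \sum_(i < n) F i.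
  by rewrite (even_eltC Ge _ (EF n)).
rewrite !big_ord_recr /= !exprD_sq0 // IH2 IH1 exprSr IH2 !mul0r mul0rn.
by rewrite !add0r mulrnAl -mulrnA factS mulnC.
Qed.

Lemma prod_pair l n : \prod_(j < n) genpair l j =
  gmon e (iota (l * p.*2.-1).+1 n.*2).
Proof.
elim: n => [|n IH]; first by rewrite big_ord0 gmon_nil.
rewrite big_ord_recr IH doubleS -addn2 iotaD gmon_cat; congr (_ * _).
by rewrite /= gmon_cons gmon_seq1 /genpair !addSn !addnS.
Qed.

Lemma sigma_pred_exp l : (l < m.*2)%N ->
  sigma l ^+ p.-1 = (gmon e (iota (l * p.*2.-1).+1 p.-1.*2)) *+ p.-1`!.
Proof.
move=> lm; rewrite /sigma lm -prod_pair.
by have [] := @sum_sq0_exp (genpair l) p.-1 (even_pair e p l) (pair_sq p Ge l).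
Qed.

(** The order is the one in which the value of [cartier_factor] produces the generators: both thetas
    first, then the pairs of each coordinate. *)
Definition block i :=
  [:: i.*2 * p.*2.-1; i.*2.+1 * p.*2.-1]%N ++
  iota (i.*2 * p.*2.-1).+1 p.-1.*2 ++ iota (i.*2.+1 * p.*2.-1).+1 p.-1.*2.

Lemma perm_block i : perm_eq (block i) (iota (i * p.*2.-1.*2) p.*2.-1.*2).
Proof.
have -> : (p.*2.-1.*2 = p.-1.*2.+1 + p.-1.*2.+1)%N.
  by move: p_gt2; case: (p) => // n _; rewrite -!addnn /=; lia.
have -> : (i * (p.-1.*2.+1 + p.-1.*2.+1) = i.*2 * p.*2.-1)%N.
  by move: p_gt2; case: (p) => // n _; rewrite -!addnn /=; nia.
rewrite iotaD /block /= perm_cons -cat1s perm_catCA perm_cat2l.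
have -> // : (i.*2.+1 * p.*2.-1 = i.*2 * p.*2.-1 + p.-1.*2.+1)%N.
by move: p_gt2; case: (p) => // n _; rewrite -!addnn /=; nia.
Qed.

Lemma perm_blocks n :
  perm_eq (flatten (map block (iota 0 n))) (iota 0 (n * p.*2.-1.*2)).
Proof.
elim: n => // n IH; rewrite -addn1 iotaD map_cat flatten_cat mulnDl iotaD.
by apply: perm_cat IH _; rewrite /= cats0 mul1n perm_block.
Qed.

Lemma cartier_factor_xval i : (i < m)%N ->
  cartier_factor p.-1 (xval 1 i.*2) (xval 1 i.*2.+1) =
  (p.-1`! * p.-1`! * 2)%:R *: gmon e (block i).
Proof.
move=> im; have im2 : (i.*2 < m.*2)%N by rewrite ltn_double.
have im3 : (i.*2.+1 < m.*2)%N by rewrite -ltn_uphalf_double /= uphalf_double.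
rewrite /xval cartier_factorE; try exact: even_sigma; last 2 first.
- by apply: oddZ; apply: odd_theta.
- by apply: oddZ; apply: odd_theta.
rewrite !sigma_pred_exp // /block gmon_cat gmon_cons gmon_seq1 gmon_cat.
rewrite !scale1r /theta im2 im3 !mulrnAr !mulrnAl -!mulrnA !mulrA scaler_nat.
by rewrite mulnA.
Qed.

Lemma fact_pred_neq0 : (p.-1`! * p.-1`! * 2)%:R != 0 :> k.
Proof.
have pp := pcharf_prime pk.
have nf n : (n < p)%N -> ~~ (p %| n`!)%N.
  elim: n => [|n IH] np; first by rewrite dvdn1 gtn_eqF ?prime_gt1.
  by rewrite factS Euclid_dvdM // negb_or IH ?(ltnW np) // gtnNdvd.
rewrite -(dvdn_pcharf pk) !Euclid_dvdM // !negb_or nf ?prednK ?prime_gt0 //.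
by rewrite gtnNdvd.
Qed.

(** The value is a nonzero multiple of the product of all [m.*2 * p.*2.-1] generators, whose degree
    exceeds the bound of [low] by one. *)
Lemma cartier_prod_not_low : (0 < m)%N ->
  ~ low (\prod_(i < m) cartier_factor p.-1 (xval 1 i.*2) (xval 1 i.*2.+1)).
Proof.
move=> m_gt0; set c := (p.-1`! * p.-1`! * 2)%:R : k.
have -> : \prod_(i < m) cartier_factor p.-1 (xval 1 i.*2) (xval 1 i.*2.+1) =
    \prod_(i < m) (c *: gmon e (block i)).
  by apply: eq_bigr => i _; apply: cartier_factor_xval.
rewrite scaler_prod prodr_const card_ord.
have -> : \prod_(i < m) gmon e (block i) = gmon e (flatten (map block (iota 0 m))).
  rewrite -(big_mkord xpredT (fun i => gmon e (block i))) /index_iota subn0.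
  elim: (iota 0 m) => [|i s IH]; first by rewrite big_nil gmon_nil.
  by rewrite big_cons IH -gmon_cat.
have cm0 : c ^+ m != 0 by rewrite expf_neq0 ?fact_pred_neq0.
move/(spanZ (c ^- m)); rewrite scalerA mulVf // scale1r.
apply: gmon_top_deg_le => //.
  by rewrite (perm_uniq (perm_blocks m)) iota_uniq.
rewrite (perm_size (perm_blocks m)) size_iota.
by move: p_gt2 m_gt0; case: (p) (m) => // n [] // j _ _ /=; nia.
Qed.

End CartierFactors.

(** * Cyclic derivatives of central polynomials *)

Fixpoint splits (i : nat) (w : seq nat) : seq (seq nat * seq nat) :=
  if w is a :: w' then
    (if a == i then [:: ([::], w')] else [::]) ++
      [seq (a :: q.1, q.2) | q <- splits i w']
  else [::].

Lemma splitsP i w q : q \in splits i w -> w = q.1 ++ i :: q.2.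
Proof.
elim: w q => //= a w IH q; rewrite mem_cat => /orP[|/mapP[r /IH -> ->]] //.
by case: eqP => // ->; rewrite inE => /eqP ->.
Qed.

Lemma size_splits i w : size (splits i w) = count_mem i w.
Proof. by elim: w => //= a w IH; rewrite size_cat size_map IH; case: eqP. Qed.

Section Cyclic.

Variables (k : fieldType) (A : algType k) (e : nat -> A) (p m : nat).
Hypotheses (Ge : is_grassmann e) (pk : p \in [pchar k]) (p_gt2 : (2 < p)%N).
Implicit Types (J s t u v w : seq nat) (x y z : A) (c : k).
Implicit Types (h : nat -> A) (L : seq (k * seq nat)).

Local Notation even_elt := (even_elt e).
Local Notation odd_elt := (odd_elt e).
Local Notation xval := (xval e p m).
Local Notation low := (low e p m).

Let k2 := two_neq0 pk p_gt2.

Lemma gmon_insert h i y w : (forall x, y * x * y = 0) ->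
  gmon (fun j => h j + (if j == i then y else 0)) w =
  gmon h w + \sum_(q <- splits i w) gmon h q.1 * y * gmon h q.2.
Proof.
move=> yxy; elim: w => [|a w IH] /=; first by rewrite !gmon_nil big_nil addr0.
rewrite !gmon_cons IH big_cat big_map /= mulrDl !mulrDr -addrA; congr (_ + _).
rewrite addrC; congr (_ + _); last first.
  by rewrite mulr_sumr; apply: eq_bigr => q _; rewrite gmon_cons !mulrA.
case: eqP => _; last by rewrite big_nil !mul0r addr0.
rewrite big_seq1 gmon_nil mul1r mulr_sumr big1 ?addr0 // => q _.
by rewrite !mulrA yxy mul0r.
Qed.

(* An element (c, (u, v)) of T stands for the linear map y |-> c u y v. *)
Definition insertion (T : seq (k * (A * A))) y :=
  \sum_(t <- T) t.1 *: (t.2.1 * y * t.2.2).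

(** For the cuts of a polynomial at a letter, this is its cyclic derivative. *)
Definition rotation (T : seq (k * (A * A))) :=
  \sum_(t <- T) t.1 *: (t.2.2 * t.2.1).

(** Carry [y] to the front of [u * y * v]: an even [y] passes freely, an odd one flips the sign of
    the odd part of [u]. The even part of [v * u] matches the odd case and its odd part the even
    case, whence [P + Q']. *)
Lemma insertion_decomp T : exists P Q P' Q',
  [/\ [/\ even_elt P, odd_elt Q, even_elt P' & odd_elt Q'],
      rotation T = P + Q',
      forall y, even_elt y -> insertion T y = y * P' + y * Q'
    & forall y, odd_elt y -> insertion T y = y * P + y * Q].
Proof.
elim: T => [|[c [u v]] T [P [Q [P' [Q' [[EP OQ EP' OQ'] rT ev_T odd_T]]]]]].
  exists 0, 0, 0, 0; rewrite /rotation /insertion big_nil addr0.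
  split; first by split; apply: span0.
  - by [].
  - by move=> y _; rewrite big_nil mulr0 addr0.
  - by move=> y _; rewrite big_nil mulr0 addr0.
have [u0 [u1 [Eu Ou ->]]] := even_odd_split Ge u.
have [v0 [v1 [Ev Ov ->]]] := even_odd_split Ge v.
have E00 := even_eltM Eu Ev; have E11 := odd_eltM Ou Ov.
have O01 := even_oddM Eu Ov; have O10 := odd_evenM Ou Ev.
exists (c *: (u0 * v0 - u1 * v1) + P), (c *: (u0 * v1 - u1 * v0) + Q),
  (c *: (u0 * v0 + u1 * v1) + P'), (c *: (u0 * v1 + u1 * v0) + Q'); split.
- split.
  + by apply: spanD EP; apply/spanZ/spanB.
  + by apply: spanD OQ; apply/spanZ/spanB.
  + by apply: spanD EP'; apply/spanZ/spanD.
  + by apply: spanD OQ'; apply/spanZ/spanD.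
- rewrite /rotation big_cons /= -/(rotation T) rT [in RHS]addrACA.
  rewrite -scalerDr mul_splitE (even_eltC Ge u0 Ev) (even_eltC Ge u1 Ev).
  rewrite -[v1 * u0](even_eltC Ge _ Eu) (odd_eltC Ge Ov Ou).
  by rewrite [u1 * v0 + _]addrC.
- move=> y Ey; rewrite /insertion big_cons /= -/(insertion T y) ev_T //.
  rewrite ![y * (c *: _ + _)]mulrDr [in RHS]addrACA -!scalerAr -scalerDr.
  congr (_ *: _ + _); rewrite -mulrDr -mul_splitE mulrA.
  by rewrite -(even_eltC Ge _ Ey).
- move=> y Oy; rewrite /insertion big_cons /= -/(insertion T y) odd_T //.
  rewrite ![y * (c *: _ + _)]mulrDr [in RHS]addrACA -!scalerAr -scalerDr.
  congr (_ *: _ + _); rewrite -mulrDr.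
  have -> : u0 * v0 - u1 * v1 + (u0 * v1 - u1 * v0) = (u0 - u1) * (v0 + v1).
    by rewrite mul_splitE !mulNr.
  rewrite mulrA; congr (_ * _).
  by rewrite mulrDl mulrBr (even_eltC Ge y Eu) (odd_eltC Ge Ou Oy).
Qed.

Lemma even_centre x : even_elt x -> @centre A x.
Proof. by move=> Ex y; apply: (even_eltC Ge). Qed.

(* The values at the e_i and at the e_i e_j see the odd parts of the sums of the
   u y v for y odd and for y even; these two parts add up to the rotation. *)
Lemma insertion_central T :
  (forall i, @centre A (insertion T (e i))) ->
  (forall i j, @centre A (insertion T (e i * e j))) ->
  rotation T = 0 /\ forall y, @centre A (insertion T y).
Proof.
have [P [Q [P' [Q' [[EP OQ EP' OQ'] -> ev_T odd_T]]]]] := insertion_decomp T.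
move=> C1 C2.
have P0 : P = 0.
  apply: (gen_torsion_freel Ge k2) => i; have Oi := odd_gen e i.
  apply: (central_odd_part Ge k2 (odd_eltM Oi OQ) (odd_evenM Oi EP)).
  by rewrite addrC -odd_T.
have Q0 : Q' = 0.
  apply: (gen_torsion_freel Ge k2) => i; apply: (gen_torsion_freel Ge k2) => j.
  have Eij := odd_eltM (odd_gen e j) (odd_gen e i).
  rewrite mulrA.
  apply: (central_odd_part Ge k2 (even_eltM Eij EP') (even_oddM Eij OQ')).
  by rewrite -ev_T.
split=> [|y]; first by rewrite P0 Q0 addr0.
have [y0 [y1 [E0 O1 ->]]] := even_odd_split Ge y.
have -> : insertion T (y0 + y1) = insertion T y0 + insertion T y1.
  rewrite /insertion -big_split; apply: eq_bigr => t _ /=.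
  by rewrite mulrDr mulrDl scalerDr.
(* With [P] and [Q'] zero, only the even elements [y0 * P'] and [y1 * Q] are left. *)
rewrite ev_T // odd_T // P0 Q0 !mulr0 addr0 add0r.
by apply/even_centre/spanD; [apply: even_eltM | apply: odd_eltM].
Qed.

Definition central_valued L := forall h, @centre A (ev h L).

Definition reweight (a : seq nat -> k) L : seq (k * seq nat) :=
  [seq (q.1 * a q.2, q.2) | q <- L].

Definition cuts h i L : seq (k * (A * A)) :=
  [seq (a.1, (gmon h q.1, gmon h q.2)) | a <- L, q <- splits i a.2].

Lemma insertion_cuts h i L y : insertion (cuts h i L) y =
  \sum_(a <- L) a.1 *: \sum_(q <- splits i a.2) gmon h q.1 * y * gmon h q.2.
Proof.
rewrite /insertion big_allpairs_dep; apply: eq_bigr => a _.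
by rewrite scaler_sumr.
Qed.

Lemma rotation_cuts h i L : rotation (cuts h i L) =
  \sum_(a <- L) a.1 *: \sum_(q <- splits i a.2) gmon h q.2 * gmon h q.1.
Proof.
rewrite /rotation big_allpairs_dep; apply: eq_bigr => a _.
by rewrite scaler_sumr.
Qed.

Lemma centreB x y : @centre A x -> @centre A y -> @centre A (x - y).
Proof.
by move=> Cx Cy z; rewrite /GRing.comm mulrBl mulrBr (Cx z) (Cy z).
Qed.

(** When [y * x * y = 0] for all [x], shifting [h i] by [y] changes the value of [L] by exactly the
    insertion of [y], which is therefore central. The [e j] and [e j * e l] are such elements. *)
Lemma central_cuts h i L : central_valued L ->
  rotation (cuts h i L) = 0 /\ forall y, @centre A (insertion (cuts h i L) y).
Proof.
move=> CL.
have C y : (forall x, y * x * y = 0) -> @centre A (insertion (cuts h i L) y).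
  move=> yxy.
  have -> : insertion (cuts h i L) y =
      ev (fun j => h j + (if j == i then y else 0)) L - ev h L.
    rewrite insertion_cuts /ev -sumrB; apply: eq_bigr => a _.
    by rewrite gmon_insert // -scalerBr addrC addKr.
  exact: centreB.
apply: insertion_central => [j|j l]; apply: C => x.
  exact: gen_sandwich.
by rewrite !mulrA -[e j * e l * x]mulrA gen_sandwich // mul0r.
Qed.

(** Euler's identity: putting [h i] back at a cut restores the word, once per occurrence. *)
Lemma ev_reweight_count h i L :
  ev h (reweight (fun w => (count_mem i w)%:R) L) = insertion (cuts h i L) (h i).
Proof.
rewrite insertion_cuts /ev big_map; apply: eq_bigr => a _ /=.
rewrite -scalerA; congr (_ *: _); rewrite scaler_nat -size_splits.
rewrite -iter_addr_0 -(count_predT (splits i a.2)) -big_const_seq.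
apply: eq_big_seq => q /splitsP {1}->.
by rewrite gmon_cat gmon_cons mulrA.
Qed.

Lemma central_reweight_count i L : central_valued L ->
  central_valued (reweight (fun w => (count_mem i w)%:R) L).
Proof. by move=> CL h; rewrite ev_reweight_count; apply: (central_cuts h i CL).2. Qed.

(** Subtracting [h i] times the vanishing cyclic derivative pairs each [u * h i * v] with its
    rotation [h i * v * u], and [low_comm] applies. *)
Lemma low_reweight_count (v : nat -> seq nat) i L : central_valued L ->
  low (ev (fun j => gmon (xval 1) (v j))
        (reweight (fun w => (count_mem i w)%:R) L)).
Proof.
set h := fun j => _; move=> CL.
have [rot0 _] := central_cuts h i CL.
rewrite ev_reweight_count -[insertion _ _]subr0.
rewrite -(mulr0 (h i)) -rot0 rotation_cuts insertion_cuts mulr_sumr -sumrB.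
apply: span_sum => a _; rewrite -scalerAr -scalerBr; apply: spanZ.
rewrite mulr_sumr -sumrB; apply: span_sum => q _.
have hw w : gmon h w = gmon (xval 1) (flatten (map v w)) by exact: gmon_flatten.
rewrite !hw /h -!gmon_cat -catA [v i ++ _ ++ _]catA.
exact: (low_comm m Ge pk p_gt2).
Qed.

Definition divisible_weight (I : seq nat) w : k :=
  \prod_(i <- I) (1 - (count_mem i w)%:R ^+ p.-1).

Lemma eq_reweight a b L : a =1 b -> reweight a L = reweight b L.
Proof. by move=> ab; apply: eq_map => q; rewrite ab. Qed.

Lemma reweight_comp a b L :
  reweight a (reweight b L) = reweight (fun w => b w * a w) L.
Proof.
by rewrite /reweight -map_comp; apply: eq_map => q /=; rewrite mulrA.
Qed.

Lemma ev_reweightB h a b L :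
  ev h (reweight (fun w => a w - b w) L) =
  ev h (reweight a L) - ev h (reweight b L).
Proof.
rewrite /ev !big_map -sumrB; apply: eq_bigr => q _ /=.
by rewrite mulrBr scalerBl.
Qed.

Lemma reweight1 L : reweight (fun=> 1) L = L.
Proof.
by rewrite /reweight -[RHS]map_id; apply: eq_map => -[c w] /=; rewrite mulr1.
Qed.

Lemma central_reweight_countX i n L : central_valued L ->
  central_valued (reweight (fun w => (count_mem i w)%:R ^+ n) L).
Proof.
move=> CL; elim: n => [|n IH].
  by under eq_reweight do rewrite expr0; rewrite reweight1.
under eq_reweight do rewrite exprSr.
by rewrite -reweight_comp; apply: central_reweight_count.
Qed.

(* By Fermat's little theorem the weight is 1 on the words in which every letter
   of I occurs a multiple of p times, and 0 on the other words. *)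
Lemma low_divisible (v : nat -> seq nat) I L : central_valued L ->
  let h := fun j => gmon (xval 1) (v j) in
  central_valued (reweight (divisible_weight I) L) /\
  low (ev h L - ev h (reweight (divisible_weight I) L)).
Proof.
move=> CL h; elim: I => [|i I [CI lowI]].
  under eq_reweight do rewrite /divisible_weight big_nil.
  by rewrite reweight1 subrr; split=> //; apply: span0.
set L1 := reweight _ L in CI lowI.
have E : reweight (divisible_weight (i :: I)) L =
    reweight (fun w => 1 - (count_mem i w)%:R ^+ p.-1) L1.
  rewrite reweight_comp; apply: eq_reweight => w.
  by rewrite /divisible_weight big_cons mulrC.
have Sp : p.-1 = p.-2.+1 by move: p_gt2; case: (p) => [|[]].
rewrite E; split=> [h'|].
  rewrite ev_reweightB reweight1; apply: centreB; first exact: CI.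
  exact: central_reweight_countX.
(* One factor of the count is kept for [low_reweight_count]; the other [p.-2] go into the
   polynomial, which stays central-valued. *)
have Ew : reweight (fun w => (count_mem i w)%:R ^+ p.-1) L1 =
    reweight (fun w => (count_mem i w)%:R)
      (reweight (fun w => (count_mem i w)%:R ^+ p.-2) L1).
  by rewrite Sp reweight_comp; apply: eq_reweight => w; rewrite exprSr.
rewrite ev_reweightB reweight1 opprB addrCA addrC; apply: spanD lowI _.
rewrite Ew; apply: low_reweight_count.
exact: central_reweight_countX.
Qed.

Lemma divisible_weight_neq0 I w i : divisible_weight I w != 0 -> i \in I ->
  (p %| count_mem i w)%N.
Proof.
move=> + iI; rewrite /divisible_weight (big_rem i) //=.
rewrite mulf_eq0 negb_or => /andP[+ _]; rewrite (dvdn_pcharf pk).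
(* If the count is nonzero in [k], its power [p.-1] is 1 by Fermat, and its factor of the weight
   vanishes. *)
apply: contraR => n0; rewrite subr_eq0 eq_sym.
rewrite -(inj_eq (mulfI n0)) mulr1 -exprS prednK; last by rewrite ltnW // ltnW.
by have := pFrobenius_aut_nat pk (count_mem i w); rewrite pFrobenius_autE => ->.
Qed.

(** A letter standing for at least two coordinates is a product of nilpotent elements occurring at
    least [p] times, so the word vanishes. Without such a letter, fewer than [m.*2] letters cannot
    cover all coordinates. *)
Lemma low_divisible_word (v : nat -> seq nat) w : (size w < m.*2)%N ->
  (forall i, i \in w -> (p %| count_mem i w)%N) ->
  low (gmon (fun j => gmon (xval 1) (v j)) w).
Proof.
move=> sw dw; have [/hasP[j jw]|/hasPn sv] := boolP (has (fun j => 1 < size (v j))%N w).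
  case vj : (v j) => [|a [|b s]] // _.
  have na := nilp_xval m Ge pk p_gt2 1 a.
  have nb : nilp e p (gmon (xval 1) (b :: s)).
    by rewrite gmon_cons; apply: nilp_mulr => //; apply: nilp_xval.
  have [h0 [h1 [E0 O1 hE hp hp1]]] := nilp_prod Ge pk p_gt2 na nb.
  rewrite (gmon_vanish Ge pk p_gt2 (j := j) E0 O1 _ hp hp1); first exact: span0.
    by rewrite -hE vj gmon_cons.
  by apply: dvdn_leq (dw j jw); rewrite -has_count has_pred1.
rewrite gmon_flatten -[gmon _ _]mul1r -(gmon_nil (theta e p m)).
apply: (low_gmon Ge pk p_gt2).
apply/orP; right; rewrite cat0s; apply: contraT => /hasPn H.
have sub : {subset iota 0 m.*2 <= flatten (map v w)}.
  by move=> l /H; rewrite negbK.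
have := uniq_leq_size (iota_uniq 0 m.*2) sub.
rewrite size_iota leqNgt => /negP[]; apply: leq_ltn_trans sw.
elim: w sv {dw H sub} => //= j w IH sv; rewrite size_cat -add1n leq_add //.
  by rewrite leqNgt; apply: sv; rewrite mem_head.
by apply: IH => l lw; apply: sv; rewrite inE lw orbT.
Qed.

Lemma low_central_valued (v : nat -> seq nat) L : central_valued L ->
  (forall a, a \in L -> size a.2 < m.*2)%N ->
  low (ev (fun j => gmon (xval 1) (v j)) L).
Proof.
(* [I] collects all letters of [L], so a nonzero weight makes every multiplicity in the word
   divisible by [p]. *)
move=> CL sL; have [_] := low_divisible v (flatten (map snd L)) CL.
set h := fun j => _; set I := flatten _.
move=> lowL; rewrite -[ev h L](subrK (ev h (reweight (divisible_weight I) L))).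
apply: spanD lowL _; rewrite /ev big_map; apply: span_sum => a aL /=.
have [->|nz] := eqVneq (divisible_weight I a.2) 0.
  by rewrite mulr0 scale0r; apply: span0.
apply/spanZ/low_divisible_word => [|i iw]; first exact: sL.
apply: (divisible_weight_neq0 nz); apply/flattenP; exists a.2 => //.
exact: map_f.
Qed.

End Cyclic.

(** * The free algebra *)

Section FreeAlgebra.

Variable k : fieldType.
Implicit Types (f : free_alg k) (L : seq (k * seq nat)) (w : seq nat).

Definition terms f : seq (k * seq nat) :=
  [seq (mcoeff w f, fmonom_val w) | w : {fmonom nat} <- msupp f].

Lemma ev_rmorph (A B : algType k) (phi : {lrmorphism A -> B}) (h : nat -> A) L :
  phi (ev h L) = ev (phi \o h) L.
Proof.
rewrite /ev linear_sum; apply: eq_bigr => a _.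
by rewrite linearZ /gmon rmorph_prod.
Qed.

Lemma eq_ev (A : algType k) (h1 h2 : nat -> A) L : h1 =1 h2 -> ev h1 L = ev h2 L.
Proof.
move=> e12; apply: eq_bigr => a _; congr (_ *: _).
by apply: eq_bigr => i _; apply: e12.
Qed.

Lemma gmon_freeX w : gmon (freeX k) w = << FMonom w >>.
Proof.
elim: w => [|i w IH].
  by rewrite gmon_nil -fmoneE.
rewrite gmon_cons IH /freeX.
rewrite [LHS](@fgmulUU _ k 1 1); rewrite mul1r; congr << _ >>.
by apply/eqP; rewrite fmP fmM fmU.
Qed.

Lemma termsE f : f = ev (freeX k) (terms f).
Proof.
rewrite /ev big_map [LHS](monalgE f); apply: eq_bigr => w _ /=.
rewrite gmon_freeX fmK; apply/malgP => u.
by rewrite mcoeffZ !mcoeffU mulrnAr mulr1.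
Qed.

Lemma lrmorph_terms (A : algType k) (phi : {lrmorphism free_alg k -> A}) f :
  phi f = ev (phi \o freeX k) (terms f).
Proof. by rewrite {1}(termsE f) ev_rmorph. Qed.

Section Evaluation.

Variables (A : algType k) (h : nat -> A).

Definition word_eval (w : {fmonom nat}) : A := gmon h w.

Fact word_eval_mmorphism : mmorphism word_eval.
Proof. by split=> [u w|]; rewrite /word_eval ?fm1 ?fmM ?gmon_cat ?gmon_nil. Qed.

HB.instance Definition _ :=
  monalg.isMultiplicative.Build {fmonom nat} A word_eval word_eval_mmorphism.

Definition free_eval (f : free_alg k) : A := mmap (in_alg A) word_eval f.

Fact free_eval_linear : linear free_eval.
Proof.
move=> c f g; rewrite /free_eval mmapD; congr (_ + _).
by rewrite mmapZ mulr_algl.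
Qed.

HB.instance Definition _ :=
  GRing.isLinear.Build k (free_alg k) A _ free_eval free_eval_linear.

Fact free_eval_monoid_morphism : monoid_morphism free_eval.
Proof.
have C (g : {malg k[{fmonom nat}]}) (u w : {fmonom nat}) :
    GRing.comm (in_alg A (mcoeff u g)) (word_eval w).
  by rewrite /GRing.comm mulr_algl mulr_algr.
have := @commr_mmap_is_multiplicative _ _ _ (in_alg A) word_eval C.
by case=> M1 M2; split.
Qed.

HB.instance Definition _ :=
  GRing.isMonoidMorphism.Build (free_alg k) A free_eval free_eval_monoid_morphism.

Lemma free_evalX i : free_eval (freeX k i) = h i.
Proof.
by rewrite /free_eval mmapU mulr_algl scale1r /word_eval fmU gmon_seq1.
Qed.

Lemma free_evalE f : free_eval f = ev h (terms f).
Proof. by rewrite lrmorph_terms; apply: eq_ev => i; apply: free_evalX. Qed.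

End Evaluation.

End FreeAlgebra.

(** * Linear changes of variables *)

Section Substitution.

Variable k : fieldType.
Implicit Types (f : free_alg k) (L : seq (k * seq nat)) (w : seq nat).

(* The variable numbered pickle s stands for the word s: each x_i is replaced by a
   linear combination of variables, so the length of the words is preserved. *)
Fixpoint subst_word (c : nat -> seq (k * seq nat)) w : seq (k * seq nat) :=
  if w is i :: w' then
    [seq (a.1 * b.1, choice.pickle a.2 :: b.2) | a <- c i, b <- subst_word c w']
  else [:: (1, [::])].

Definition subst (c : nat -> seq (k * seq nat)) L : seq (k * seq nat) :=
  [seq (a.1 * b.1, b.2) | a <- L, b <- subst_word c a.2].

Lemma size_subst_word c w b : b \in subst_word c w -> size b.2 = size w.
Proof.
elim: w b => [|i w IH] b /=; first by rewrite inE => /eqP ->.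
by move=> /allpairsP[[a d] /= [_ /IH <- ->]].
Qed.

Lemma ev_subst_word (A : algType k) (h : nat -> A) c w :
  ev h (subst_word c w) =
  gmon (fun i => \sum_(a <- c i) a.1 *: h (choice.pickle a.2)) w.
Proof.
elim: w => [|i w IH]; first by rewrite /ev big_seq1 scale1r !gmon_nil.
rewrite gmon_cons -IH /ev big_allpairs_dep mulr_suml; apply: eq_bigr => a _.
rewrite mulr_sumr; apply: eq_bigr => b _ /=.
by rewrite gmon_cons -scalerAl -scalerAr scalerA.
Qed.

Lemma ev_subst (A : algType k) (h : nat -> A) c L :
  ev h (subst c L) = ev (fun i => \sum_(a <- c i) a.1 *: h (choice.pickle a.2)) L.
Proof.
rewrite /ev big_allpairs_dep; apply: eq_bigr => a _ /=.
rewrite -ev_subst_word scaler_sumr; apply: eq_bigr => b _ /=.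
by rewrite scalerA.
Qed.

End Substitution.

(** * The increasing T-spaces and the conclusion *)

Local Open Scope classical_set_scope.

Lemma finite_set_bound (T : choiceType) (H : set T) (V : nat -> set T) :
  (forall m n, (m <= n)%N -> V m `<=` V n) -> finite_set H ->
  (forall x, H x -> exists n, V n x) -> exists n, H `<=` V n.
Proof.
move=> Vmono /finite_seqP[s ->]; elim: s => [|x s IH] VH; first by exists 0%N.
have [y|n Vn] := IH; first by move=> ys; apply: VH; rewrite /= inE ys orbT.
have [|m Vm] := VH x; first by rewrite /= mem_head.
exists (maxn m n) => y /=; rewrite inE => /orP[/eqP->|ys].
  exact: Vmono (leq_maxl m n) _ Vm.
by apply: Vmono (leq_maxr m n) _ _; apply: Vn.
Qed.

Section NotFinitelyBased.

Variables (p : nat) (k : fieldType) (G : algType k) (e : nat -> G).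
Hypotheses (Ge : is_grassmann e) (pk : p \in [pchar k]) (p_gt2 : (2 < p)%N).
Implicit Types (f : free_alg k).

Definition cartier_low N : set (free_alg k) := [set f |
  forall m, (N < m)%N -> forall psi : {lrmorphism free_alg k -> free_alg k},
    low e p m (free_eval (xval e p m 1) (psi f))].

Lemma Tspace_cartier_low N : Tspace (cartier_low N).
Proof.
split=> [m _ psi|c f g Vf Vg m Nm psi|phi f Vf m Nm psi].
- by rewrite !linear0; apply: span0.
- by rewrite !linearP; apply: spanD; [apply/spanZ/Vf | apply: Vg].
- exact: (Vf m Nm (psi \o phi)).
Qed.

Lemma cartier_lowS M N : (M <= N)%N -> cartier_low M `<=` cartier_low N.
Proof. by move=> MN f Vf m /(leq_ltn_trans MN); apply: Vf. Qed.

Lemma central_cartier_low f :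
  (forall phi : {lrmorphism free_alg k -> G}, @centre G (phi f)) ->
  exists N, cartier_low N f.
Proof.
(* The bound is the largest word length in [f]; substitution keeps lengths, so for larger [m] all
   words are shorter than [m.*2]. *)
move=> Cf; exists (\max_(a <- terms f) size a.2) => m Nm psi.
(* [v] decodes a variable into the word it stands for, and [c i] gives the terms of the image of
   [x_i] under [psi]. *)
pose v j : seq nat := odflt [::] (choice.unpickle j).
pose c i := terms (psi (freeX k i)).
pose L := subst c (terms f).
suff -> : free_eval (xval e p m 1) (psi f) = ev (fun j => gmon (xval e p m 1) (v j)) L.
  apply: (low_central_valued Ge pk p_gt2) => [h|_ /allpairsPdep[a [b [af bw ->]]]].
    by rewrite ev_subst -free_evalE; apply: Cf.
  rewrite /= (size_subst_word bw) -addnn; apply: ltn_addr.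
  apply: leq_ltn_trans Nm.
  exact: (@leq_bigmax_seq _ _ xpredT (fun a : k * seq nat => size a.2)).
rewrite ev_subst -[LHS]/((free_eval (xval e p m 1) \o psi) f) lrmorph_terms.
apply: eq_ev => i /=; rewrite free_evalE; apply: eq_bigr => a _.
by rewrite /v choice.pickleK.
Qed.

Definition cartier_word m : free_alg k := 
  \prod_(i < m) cartier_factor p.-1 (freeX k i.*2) (freeX k i.*2.+1).

Lemma lrmorph_cartier_word (A : algType k) (phi : {lrmorphism free_alg k -> A}) m :
  phi (cartier_word m) = \prod_(i < m)
    cartier_factor p.-1 (phi (freeX k i.*2)) (phi (freeX k i.*2.+1)).
Proof.
rewrite /cartier_word rmorph_prod; apply: eq_bigr => i _.
exact: (rmorph_cartier_factor phi).
Qed.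

Lemma cartier_word_not_low m : (0 < m)%N ->
  ~ low e p m (free_eval (xval e p m 1) (cartier_word m)).
Proof.
move=> m_gt0; rewrite lrmorph_cartier_word.
under eq_bigr do rewrite /= !(free_evalX (xval e p m 1)).
exact: (cartier_prod_not_low Ge pk p_gt2 m_gt0).
Qed.

Lemma central_cartier_word m : (0 < m)%N ->
  central_polynomial G (cartier_word m).
Proof.
case: m => // m _; split=> [||phi].
(* The coefficient of the empty word is a ring morphism into the commutative [k], so it kills the
   commutator in the first factor. *)
- rewrite /free_alg0 /= /cartier_word big_ord_recl.
  rewrite (rmorphM (mcoeff (mone : {fmonom nat}))).
  rewrite (rmorph_cartier_factor (mcoeff (mone : {fmonom nat}))).
  by rewrite /cartier_factor [X in _ - X]mulrC subrr !mul0r.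
- case=> _ T0; apply: (@cartier_word_not_low m.+1 isT).
  by rewrite T0; apply: span0.
- apply: (even_centre Ge); rewrite lrmorph_cartier_word.
  apply: (big_ind (even_elt e)) => [||i _]; first exact: even_elt1.
    by move=> x y; apply: even_eltM.
  have [x0 [x1 [E0 O1 ->]]] := even_odd_split Ge (phi (freeX k i.*2)).
  have [y0 [y1 [F0 F1 ->]]] := even_odd_split Ge (phi (freeX k i.*2.+1)).
  rewrite (cartier_factorE Ge pk p_gt2) // -scaler_nat; apply: spanZ.
  by do 2![apply: even_eltM; last exact: even_eltX]; apply: odd_eltM.
Qed.

End NotFinitelyBased.

Theorem theorem3p1 (p : nat) (k : fieldType) (G : algType k) (e : nat -> G) :
  prime p -> (2 < p)%N -> p \in [pchar k]%R -> is_grassmann e ->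
  ~ finitely_based (CP G).
Proof.
move=> _ p_gt2 pk Ge [H finH CPH].
have HCP : H `<=` CP G by rewrite CPH; apply: sub_smallest.
have CPlow f : CP G f -> exists N, cartier_low p e N f.
  (* The increasing union is itself a T-space, so only the central polynomials have to be
     checked. *)
  apply: (@smallest_sub _ (@Tspace k) _ [set f | exists N, cartier_low p e N f]).
    split=> [|c g1 g2 [M V1] [N V2]|phi g [N V]].
    - by exists 0%N; have [] := Tspace_cartier_low p e 0.
    - exists (maxn M N); have [_ lin _] := Tspace_cartier_low p e (maxn M N).
      apply: lin; first exact: cartier_lowS (leq_maxl M N) _ V1.
      exact: cartier_lowS (leq_maxr M N) _ V2.
    - by exists N; have [_ _ sub] := Tspace_cartier_low p e N; apply: sub.
  by move=> g [_ _ Cg]; apply: (central_cartier_low Ge pk p_gt2).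
have [N HN] : exists N, H `<=` cartier_low p e N.
  apply: finite_set_bound finH _ => [m n|f Hf]; first exact: cartier_lowS.
  by apply: CPlow; apply: HCP.
have CPN : CP G `<=` cartier_low p e N.
  by rewrite CPH; apply: smallest_sub HN; apply: Tspace_cartier_low.
(* The contradiction comes from [m = N.+1], the first index beyond [N], with the identity as
   substitution. *)
apply: (cartier_word_not_low Ge pk p_gt2 (ltn0Sn N)).
have Cw := central_cartier_word Ge pk p_gt2 (ltn0Sn N).
have CPw : CP G (cartier_word p k N.+1) by apply: sub_smallest Cw.
exact: (CPN _ CPw N.+1 (ltnSn N) idfun).
Qed.
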